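(* Let $M$ be an $m$-dimensional smooth manifold. The minimal ideal of $\Gamma^\infty(\bigwedge^\bullet T^*M)$ is given by $\Gamma^\infty(\bigwedge^+T^*M)$. Thus the representation theories of $\Gamma^\infty(\bigwedge^\bullet T^*M)$ and $C^\infty(M)$ are equivalent, but the algebras are not formally Morita equivalent. The closed ideals of $\Gamma^\infty(\bigwedge^\bullet T^*M)$ are of the form $\mathcal I\oplus\Gamma^\infty(\bigwedge^+T^*M)$, where $\mathcal I$ is a closed ideal of $C^\infty(M)$.
   Context: $\bigwedge^\bullet T^*M$ is the complexified Grassmann (exterior) algebra bundle of $M$, and $\bigwedge^+T^*M$ is the subbundle of forms of positive degree. $\Gamma^\infty$ denotes smooth sections. $\Gamma^\infty(\bigwedge^\bullet T^*M)$ is a $^*$-algebra over $\mathbb C$ under the wedge product, with the $^*$-involution obtained by declaring real one-forms to be Hermitian and extending to an antilinear anti-automorphism. $C^\infty(M)$ is the $^*$-algebra of complex-valued smooth functions with complex conjugation, identified with the degree-zero part. A complex pre-Hilbert space $\mathfrak H$ is a complex vector space with positive-definite Hermitian product, linear in the second argument; $\mathfrak B(\mathfrak H)$ is the $^*$-algebra of all linear maps $\mathfrak H\to\mathfrak H$ having an adjoint on $\mathfrak H$. A $^*$-representation of a complex $^*$-algebra $\mathcal A$ is a $^*$-homomorphism $\pi:\mathcal A\to\mathfrak B(\mathfrak H)$; it is strongly non-degenerate if the vectors $\pi(A)\phi$ span $\mathfrak H$. Categories of $^*$-representations have isometric intertwiners as morphisms; equivalence of the representation theories of two $^*$-algebras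 means equivalence of their categories of $^*$-representations, and of strongly non-degenerate $^*$-representations. A closed ideal (closed $^*$-ideal) of $\mathcal A$ is the kernel of some $^*$-representation on a complex pre-Hilbert space; the minimal ideal of $\mathcal A$ is the intersection of all closed $^*$-ideals. A linear functional $\omega$ on $\mathcal A$ is positive if $\omega(A^*A)\ge0$ for all $A$; $\mathcal A^+$ is the set of Hermitian $A$ with $\omega(A)\ge0$ for all positive $\omega$. Formal Morita equivalence. For a right $\mathcal A$-module $\mathfrak X$ (with compatible $\mathbb C$-vector space structure), an $\mathcal A$-valued inner product is a map $\langle\cdot,\cdot\rangle_{\mathcal A}:\mathfrak X\times\mathfrak X\to\mathcal A$, $\mathbb C$- and right $\mathcal A$-linear in the second argument, with $\langle x,y\rangle_{\mathcal A}=\langle y,x\rangle_{\mathcal A}^*$. It is positive semi-definite if $\langle x,x\rangle_{\mathcal A}\in\mathcal A^+$ for all $x$, and full if the span of all $\langle x,y\rangle_{\mathcal A}$ is $\mathcal A$. For a left $\mathcal B$-module, ${}_{\mathcal B}\langle\cdot,\cdot\rangle$ is analogous with linearity in the first argument. $\mathcal A$ and $\mathcal B$ are formally Morita equivalent if there is a $(\mathcal B$-$\mathcal A)$-bimodule $\mathfrak X$ with full positive semi-definite inner products $\langle\cdot,\cdot\rangle_{\mathcal A}$ and ${}_{\mathcal B}\langle\cdot,\cdot\rangle$ such that: $\langle B\cdot x,y\rangle_{\mathcal A}=\langle x,B^*\cdot y\rangle_{\mathcal A}$ and ${}_{\mathcal B}\langle x\cdot A,y\rangle={}_{\mathcal B}\langle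 x,y\cdot A^*\rangle$; $x\cdot\langle y,z\rangle_{\mathcal A}={}_{\mathcal B}\langle x,y\rangle\cdot z$; property P: for every $^*$-representation $(\pi,\mathfrak H)$ of $\mathcal A$ the Hermitian product on $\mathfrak X\otimes_{\mathcal A}\mathfrak H$ determined by $\langle x\otimes\psi,y\otimes\phi\rangle=\langle\psi,\pi(\langle x,y\rangle_{\mathcal A})\phi\rangle_{\mathfrak H}$ is positive semi-definite; property Q: the conjugate $(\mathcal A$-$\mathcal B)$-bimodule $\overline{\mathfrak X}$ (same additive group, elements $\overline x$, with $z\overline x=\overline{\overline zx}$, $A\cdot\overline x=\overline{x\cdot A^*}$, $\overline x\cdot B=\overline{B^*\cdot x}$, $\langle\overline x,\overline y\rangle_{\mathcal B}={}_{\mathcal B}\langle x,y\rangle$) has property P with respect to $\mathcal B$.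
   Formalization: The claim that the algebras are not formally Morita equivalent is stated only for m > 0 and M nonempty, since for m = 0 or M empty the two algebras coincide and are formally Morita equivalent; the other claims are stated for every M. *)

(* Defs.v *)
From HB Require Import structures.
From mathcomp Require Import all_boot all_order all_algebra.
From mathcomp Require Import generic_quotient.
From mathcomp Require Import all_classical all_reals all_analysis.
From mathcomp Require Import complex.

Set Implicit Arguments.
Unset Strict Implicit.
Unset Printing Implicit Defensive.

Import Order.TTheory GRing.Theory Num.Theory.
Import numFieldNormedType.Exports.
Local Open Scope classical_set_scope.
Local Open Scope ring_scope.

(* [GRing.Algebra] is not reused: it requires a unit distinct from 0. *)
HB.mixin Record isStarAlgebra (C : numClosedFieldType) A
    of GRing.Lmodule C A := {
  amul : A -> A -> A;
  amulA : associative amul;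
  amul_linl : forall a, linear (amul^~ a);
  amul_linr : forall a, linear (amul a);
  star : A -> A;
  starP : forall (z : C) a b, star (z *: a + b) = z^* *: star a + star b;
  starM : forall a b, star (amul a b) = amul (star b) (star a);
  starK : involutive star
}.

#[short(type="starAlgType")]
HB.structure Definition StarAlgebra (C : numClosedFieldType) :=
  {A of GRing.Lmodule C A & isStarAlgebra C A}.

Notation "a ** b" := (amul a b) (at level 40, left associativity) : ring_scope.

Definition positive_functional (C : numClosedFieldType) (A : starAlgType C)
  (w : {scalar A}) : Prop := forall a : A, 0 <= w (star a ** a).

Definition positive_elements (C : numClosedFieldType) (A : starAlgType C) :
    set A :=
  [set a | star a = a /\
           forall w : {scalar A}, positive_functional w -> 0 <= w a].

HB.mixin Record isPreHilbert (C : numClosedFieldType) H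
    of GRing.Lmodule C H := {
  hip : H -> H -> C;
  hip_linear : forall x (z : C) y y',
    hip x (z *: y + y') = z * hip x y + hip x y';
  hip_conj : forall x y, hip x y = (hip y x)^*;
  hip_posdef : forall x, x != 0 -> 0 < hip x x
}.

#[short(type="preHilbertType")]
HB.structure Definition PreHilbert (C : numClosedFieldType) :=
  {H of GRing.Lmodule C H & isPreHilbert C H}.

Definition adjoint_pair (C : numClosedFieldType) (H : preHilbertType C)
  (f g : H -> H) : Prop := forall x y, hip (f x) y = hip x (g y).

(* Adjoints on a pre-Hilbert space are unique, so [rep_star] says both that
   [rep_op a] has an adjoint and that this adjoint is [rep_op (star a)]. *)
Record starRep (C : numClosedFieldType) (A : starAlgType C) := StarRep {
  rep_space :> preHilbertType C;
  rep_op : A -> rep_space -> rep_space;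
  rep_linear : forall a, linear (rep_op a);
  rep_star : forall a, adjoint_pair (rep_op a) (rep_op (star a));
  repP : forall (z : C) a b x,
    rep_op (z *: a + b) x = z *: rep_op a x + rep_op b x;
  repM : forall a b x, rep_op (a ** b) x = rep_op a (rep_op b x)
}.

Definition strongly_nondegenerate (C : numClosedFieldType)
    (A : starAlgType C) (pi : starRep A) : Prop :=
  forall x : pi, exists (n : nat) (z : 'I_n -> C) (a : 'I_n -> A)
    (y : 'I_n -> pi), x = \sum_(i < n) z i *: rep_op (a i) (y i).

Definition rep_kernel (C : numClosedFieldType) (A : starAlgType C)
  (pi : starRep A) : set A := [set a | forall x : pi, rep_op a x = 0].

Definition closed_ideal (C : numClosedFieldType) (A : starAlgType C)
  (J : set A) : Prop := exists pi : starRep A, J = rep_kernel pi.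

Definition minimal_ideal (C : numClosedFieldType) (A : starAlgType C) :
  set A := \bigcap_(J in @closed_ideal C A) J.
Arguments minimal_ideal {C} A.

Record category := Category {
  obj :> Type;
  cat_hom : obj -> obj -> Type;
  cat_id : forall x, cat_hom x x;
  cat_comp : forall x y z, cat_hom y z -> cat_hom x y -> cat_hom x z;
  comp_idl : forall x y (f : cat_hom x y), cat_comp (cat_id y) f = f;
  comp_idr : forall x y (f : cat_hom x y), cat_comp f (cat_id x) = f;
  comp_assoc : forall x y z t
      (f : cat_hom z t) (g : cat_hom y z) (h : cat_hom x y),
    cat_comp f (cat_comp g h) = cat_comp (cat_comp f g) h
}.
Arguments cat_id {c} x.
Arguments cat_comp {c x y z}.

Record functor (D E : category) := Functor {
  fobj :> D -> E;
  fhom : forall x y, cat_hom x y -> cat_hom (fobj x) (fobj y);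
  fhom_id : forall x, fhom (cat_id x) = cat_id (fobj x);
  fhom_comp : forall x y z (f : cat_hom y z) (g : cat_hom x y),
    fhom (cat_comp f g) = cat_comp (fhom f) (fhom g)
}.
Arguments fhom {D E} _ {x y} _.

Program Definition functor_id (D : category) : functor D D :=
  @Functor D D id (fun _ _ f => f) _ _.
Next Obligation. by []. Qed.
Next Obligation. by []. Qed.

Program Definition functor_comp (D E F : category)
    (S : functor E F) (T : functor D E) : functor D F :=
  @Functor D F (S \o T) (fun _ _ f => fhom S (fhom T f)) _ _.
Next Obligation. by move=> D E F S T x /=; rewrite !fhom_id. Qed.
Next Obligation. by move=> D E F S T x y z f g /=; rewrite !fhom_comp. Qed.

Definition naturally_isomorphic (D E : category) (S T : functor D E) : Prop :=
  exists (u : forall x, cat_hom (S x) (T x))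
         (v : forall x, cat_hom (T x) (S x)),
    [/\ forall x y (f : cat_hom x y),
          cat_comp (u y) (fhom S f) = cat_comp (fhom T f) (u x),
        forall x, cat_comp (v x) (u x) = cat_id (S x)
      & forall x, cat_comp (u x) (v x) = cat_id (T x)].

Definition equivalent_categories (D E : category) : Prop :=
  exists (S : functor D E) (T : functor E D),
    naturally_isomorphic (functor_comp T S) (functor_id D) /\
    naturally_isomorphic (functor_comp S T) (functor_id E).

Program Definition full_subcategory (D : category) (P : D -> Prop) : category :=
  @Category {x : D | P x} (fun x y => cat_hom (sval x) (sval y))
    (fun x => cat_id (sval x)) (fun _ _ _ => cat_comp) _ _ _.
Next Obligation. by move=> D P x y f; exact: comp_idl. Qed.
Next Obligation. by move=> D P x y f; exact: comp_idr. Qed.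
Next Obligation. by move=> D P x y z t f g h; exact: comp_assoc. Qed.

Record intertwiner (C : numClosedFieldType) (A : starAlgType C)
    (pi rho : starRep A) := Intertwiner {
  itw :> pi -> rho;
  itw_linear : linear itw;
  itw_isometric : forall x y, hip (itw x) (itw y) = hip x y;
  itw_comm : forall a x, itw (rep_op a x) = rep_op a (itw x)
}.

Lemma intertwiner_eq (C : numClosedFieldType) (A : starAlgType C)
  (pi rho : starRep A) (S T : intertwiner pi rho) : S =1 T -> S = T.
Proof.
case: S T => [S S1 S2 S3] [T T1 T2 T3] /= /funext E; case: T / E in T1 T2 T3 *.
by congr Intertwiner; exact: Prop_irrelevance.
Qed.

Program Definition intertwiner_id (C : numClosedFieldType) (A : starAlgType C)
  (pi : starRep A) : intertwiner pi pi := @Intertwiner C A pi pi id _ _ _.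
Next Obligation. by []. Qed.
Next Obligation. by []. Qed.
Next Obligation. by []. Qed.

Program Definition intertwiner_comp (C : numClosedFieldType)
    (A : starAlgType C) (pi rho tau : starRep A)
    (S : intertwiner rho tau) (T : intertwiner pi rho) : intertwiner pi tau :=
  @Intertwiner C A pi tau (S \o T) _ _ _.
Next Obligation.
by move=> C A pi rho tau S T z x y /=; rewrite !itw_linear. Qed.
Next Obligation.
by move=> C A pi rho tau S T x y /=; rewrite !itw_isometric. Qed.
Next Obligation.
by move=> C A pi rho tau S T a x /=; rewrite !itw_comm. Qed.

Program Definition rep_category (C : numClosedFieldType) (A : starAlgType C) :
    category :=
  @Category (starRep A) (@intertwiner C A) (@intertwiner_id C A)
    (fun x y z => @intertwiner_comp C A x y z) _ _ _.
Next Obligation. by move=> C A x y f; exact: intertwiner_eq. Qed.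
Next Obligation. by move=> C A x y f; exact: intertwiner_eq. Qed.
Next Obligation. by move=> C A x y z t f g h; exact: intertwiner_eq. Qed.

Definition equivalent_representation_theories (C : numClosedFieldType)
    (A B : starAlgType C) : Prop :=
  equivalent_categories (rep_category A) (rep_category B) /\
  equivalent_categories
    (full_subcategory (D := rep_category A) (@strongly_nondegenerate C A))
    (full_subcategory (D := rep_category B) (@strongly_nondegenerate C B)).

Record rightInnerModule (C : numClosedFieldType) (A : starAlgType C) :=
    RightInnerModule {
  rim_carrier :> lmodType C;
  ract : rim_carrier -> A -> rim_carrier;
  ract_linl : forall a, linear (ract^~ a);
  ract_linr : forall x, linear (ract x);
  ractM : forall x a b, ract x (a ** b) = ract (ract x a) b;
  rip : rim_carrier -> rim_carrier -> A;
  rip_lin : forall x, linear (rip x);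
  rip_act : forall x y a, rip x (ract y a) = rip x y ** a;
  rip_star : forall x y, rip x y = star (rip y x)
}.

Definition semidefinite_inner_product (C : numClosedFieldType)
  (A : starAlgType C) (X : Type) (ip : X -> X -> A) : Prop := forall x, positive_elements (ip x x).

Definition full_inner_product (C : numClosedFieldType) (A : starAlgType C)
    (X : Type) (ip : X -> X -> A) : Prop :=
  forall a : A, exists (n : nat) (z : 'I_n -> C) (x y : 'I_n -> X),
    a = \sum_(i < n) z i *: ip (x i) (y i).

Section TensorProduct.
Local Open Scope quotient_scope.
Variables (C : numClosedFieldType) (A : starAlgType C).
Variables (X : rightInnerModule A) (pi : starRep A).

Definition balanced (W : lmodType C) (b : X -> pi -> W) : Prop :=
  [/\ forall h, linear (b^~ h), forall x, linear (b x)
    & forall x a h, b (ract x a) h = b x (rep_op a h)].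

(* An element of the tensor product over [A] is represented by a list of pairs,
   the sum of the corresponding elementary tensors; two lists represent the
   same element iff no balanced map separates them. *)
Definition tensor_eq (s t : seq (X * pi)) : Prop :=
  forall (W : lmodType C) (b : X -> pi -> W), balanced b ->
    \sum_(u <- s) b u.1 u.2 = \sum_(u <- t) b u.1 u.2.

Definition tensor_eqb (s t : seq (X * pi)) : bool := `[< tensor_eq s t >].

Lemma tensor_eqb_equiv : equiv_class_of tensor_eqb.
Proof.
split.
- by move=> s; apply/asboolP.
- move=> s t; apply/asboolP/asboolP => st W b bb.
    by apply: esym; exact: st.
  by apply: esym; exact: st.
- move=> t s u /asboolP st /asboolP tu; apply/asboolP => W b bb.
  by rewrite (st _ _ bb) (tu _ _ bb).
Qed.

Local Canonical tensor_equiv := EquivRelPack tensor_eqb_equiv.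

Definition tensor : Type := {eq_quot tensor_equiv}.

Definition tensor_of (s : seq (X * pi)) : tensor :=
  \pi_{eq_quot tensor_equiv} s.

Definition tensor_repr (t : tensor) : seq (X * pi) :=
  repr (t : {eq_quot tensor_equiv}).

Definition list_ip (s t : seq (X * pi)) : C :=
  \sum_(u <- s) \sum_(v <- t) hip u.2 (rep_op (rip u.1 v.1) v.2).

Definition tensor_ip (t t' : tensor) : C :=
  list_ip (tensor_repr t) (tensor_repr t').

Lemma tensor_reprK s : tensor_eq (tensor_repr (tensor_of s)) s.
Proof.
by apply/asboolP/(@eqquotP _ tensor_equiv); exact: (reprK (tensor_of s)).
Qed.

Lemma hipDr (H : preHilbertType C) (x y z : H) :
  hip x (y + z) = hip x y + hip x z.
Proof. by rewrite -[y]scale1r hip_linear mul1r scale1r. Qed.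

Lemma list_ip_balanced s :
  @balanced C^o (fun x h => \sum_(u <- s) hip u.2 (rep_op (rip u.1 x) h)).
Proof.
split.
- move=> h z x y; rewrite scaler_sumr -big_split; apply: eq_bigr => u _ /=.
  by rewrite rip_lin repP hip_linear.
- move=> x z h k; rewrite scaler_sumr -big_split; apply: eq_bigr => u _ /=.
  by rewrite rep_linear hip_linear.
- by move=> x a h; apply: eq_bigr => u _; rewrite rip_act repM.
Qed.

Lemma list_ip_eqr s t t' : tensor_eq t t' -> list_ip s t = list_ip s t'.
Proof.
by move=> /(_ _ _ (list_ip_balanced s)); rewrite /list_ip exchange_big => ->;
   rewrite exchange_big.
Qed.

Lemma list_ip_conj s t : list_ip s t = (list_ip t s)^*.
Proof.
rewrite /list_ip rmorph_sum exchange_big /=; apply: eq_bigr => u _.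
rewrite rmorph_sum; apply: eq_bigr => v _ /=.
by rewrite -hip_conj rep_star -rip_star.
Qed.

Lemma tensor_ipE s t : tensor_ip (tensor_of s) (tensor_of t) = list_ip s t.
Proof.
rewrite /tensor_ip (list_ip_eqr _ (tensor_reprK t)) list_ip_conj.
by rewrite (list_ip_eqr _ (tensor_reprK s)) -list_ip_conj.
Qed.

End TensorProduct.

Definition propertyP (C : numClosedFieldType) (A : starAlgType C)
    (X : rightInnerModule A) : Prop :=
  forall (pi : starRep A) (t : tensor X pi), 0 <= tensor_ip t t.

Definition conj_space (C : numClosedFieldType) (X : lmodType C) : Type := X.

Section ConjSpace.
Variables (C : numClosedFieldType) (X : lmodType C).

Definition conj_scale (z : C) (x : conj_space X) : conj_space X :=
  z^* *: (x : X).

HB.instance Definition _ := GRing.Zmodule.copy (conj_space X) X.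

Fact conj_scaleA z w (x : conj_space X) :
  conj_scale z (conj_scale w x) = conj_scale (z * w) x.
Proof. by rewrite /conj_scale scalerA rmorphM. Qed.

Fact conj_scale1 : left_id 1 conj_scale.
Proof. by move=> x; rewrite /conj_scale rmorph1 scale1r. Qed.

Fact conj_scaleDr : right_distributive conj_scale +%R.
Proof. by move=> z x y; rewrite /conj_scale scalerDr. Qed.

Fact conj_scaleDl x : {morph conj_scale^~ x : z w / z + w}.
Proof. by move=> z w; rewrite /conj_scale rmorphD scalerDl. Qed.

HB.instance Definition _ := GRing.Zmodule_isLmodule.Build C (conj_space X)
  conj_scaleA conj_scale1 conj_scaleDr conj_scaleDl.

End ConjSpace.

Record innerBimodule (C : numClosedFieldType) (B A : starAlgType C) :=
    InnerBimodule {
  ibm_right :> rightInnerModule A;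
  lact : B -> ibm_right -> ibm_right;
  lact_linl : forall x, linear (lact^~ x);
  lact_linr : forall b, linear (lact b);
  lactM : forall b c x, lact (b ** c) x = lact b (lact c x);
  lract : forall b x a, ract (lact b x) a = lact b (ract x a);
  lip : ibm_right -> ibm_right -> B;
  lip_lin : forall y, linear (lip^~ y);
  lip_act : forall b x y, lip (lact b x) y = b ** lip x y;
  lip_star : forall x y, lip x y = star (lip y x)
}.

Section Conjugate.
Variables (C : numClosedFieldType) (B A : starAlgType C).
Variable X : innerBimodule B A.

Let act (x : conj_space X) (b : B) : conj_space X := lact (star b) (x : X).
Let ip (x y : conj_space X) : B := lip (x : X) (y : X).

Fact conj_act_linl b : linear (act^~ b).
Proof. by move=> z x y; rewrite /act lact_linr. Qed.

Fact conj_act_linr x : linear (act x).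
Proof. by move=> z b c; rewrite /act starP lact_linl. Qed.

Fact conj_actM x b c : act x (b ** c) = act (act x b) c.
Proof. by rewrite /act starM lactM. Qed.

Fact conj_ip_lin x : linear (ip x).
Proof.
move=> z y y'; rewrite /ip [LHS]lip_star lip_lin starP conjCK.
by rewrite -!lip_star.
Qed.

Fact conj_ip_act x y b : ip x (act y b) = ip x y ** b.
Proof. by rewrite /ip /act [LHS]lip_star lip_act starM starK -lip_star. Qed.

Fact conj_ip_star x y : ip x y = star (ip y x).
Proof. exact: lip_star. Qed.

Definition conjugate : rightInnerModule B :=
  RightInnerModule conj_act_linl conj_act_linr conj_actM
    conj_ip_lin conj_ip_act conj_ip_star.

End Conjugate.

Record equivalence_bimodule (C : numClosedFieldType)
    (B A : starAlgType C) (X : innerBimodule B A) : Prop := {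
  eqb_right_semidefinite : semidefinite_inner_product (@rip _ _ X);
  eqb_left_semidefinite : semidefinite_inner_product (@lip _ _ _ X);
  eqb_right_full : full_inner_product (@rip _ _ X);
  eqb_left_full : full_inner_product (@lip _ _ _ X);
  eqb_lact : forall (b : B) (x y : X),
    rip (lact b x) y = rip x (lact (star b) y);
  eqb_ract : forall (a : A) (x y : X),
    lip (ract x a) y = lip x (ract y (star a));
  eqb_compatible : forall x y z : X, ract x (rip y z) = lact (lip x y) z;
  eqb_P : propertyP X;
  eqb_Q : propertyP (conjugate X)
}.

Definition formally_Morita_equivalent (C : numClosedFieldType)
    (A B : starAlgType C) : Prop :=
  exists X : innerBimodule B A, equivalence_bimodule X.

Lemma near_eq_differentiable (R : realType) (V W : normedModType R)
    (f g : V -> W) x :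
  (\forall y \near x, f y = g y) -> differentiable f x -> differentiable g x.
Proof.
move=> fg df.
have fgx : f x = g x by exact: nbhs_singleton fg.
have E : g \o shift x = cst (g x) + 'd f x +o_ 0 id.
  apply/eqaddoP => e e0; have /eqaddoP/(_ _ e0) := diff_locally df.
  move/nbhs0P: fg => fg; apply: filterS2 fg => h /= fg.
  by rewrite !fctE /= [h + x]addrC -fg -fgx.
have D : 'd g x = 'd f x :> (_ -> _).
  by apply: diff_unique => //; exact: diff_continuous.
by apply/diff_locallyP; split; rewrite D//; exact: diff_continuous.
Qed.

Lemma derive_comp (R : realType) (U V W : normedModType R) (f : U -> V)
    (g : V -> W) x u : differentiable f x -> differentiable g (f x) ->
  'D_u (g \o f) x = 'D_('D_u f x) g (f x).
Proof.
move=> df dg; rewrite !deriveE//; last exact: differentiable_comp.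
by rewrite diff_comp.
Qed.

Lemma near_eq_jacobian (R : realType) (m n : nat) (f g : 'rV[R]_m -> 'rV[R]_n)
    x (u : 'rV[R]_m) : (\forall y \near x, f y = g y) -> differentiable f x ->
  u *m jacobian f x = u *m jacobian g x.
Proof.
move=> fg df; have dg := near_eq_differentiable fg df.
have E := near_eq_derive u fg.
exact: etrans (esym (deriveEjacobian u df)) (etrans E (deriveEjacobian u dg)).
Qed.

Lemma jacobian_comp (R : realType) (m n q : nat) (f : 'rV[R]_m -> 'rV[R]_n)
    (g : 'rV[R]_n -> 'rV[R]_q) x (u : 'rV[R]_m) :
  differentiable f x -> differentiable g (f x) ->
  u *m jacobian (g \o f) x = u *m jacobian f x *m jacobian g (f x).
Proof.
move=> df dg; have dgf := differentiable_comp df dg.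
have E := derive_comp u df dg.
have E1 := deriveEjacobian u dgf.
have E2 := deriveEjacobian u df.
have E3 := deriveEjacobian ('D_u f x) dg.
exact: etrans (esym E1) (etrans E (etrans E3 (congr1 (mulmx^~ _) E2))).
Qed.

Section Smooth.
Variables (R : realType) (m : nat) (W : normedModType R).
Implicit Types (U : set 'rV[R]_m) (f g : 'rV[R]_m -> W).

Fixpoint differentiable_upto (k : nat) U f : Prop :=
  if k is k'.+1 then
    (forall x, U x -> differentiable f x) /\
    (forall a : 'I_m, differentiable_upto k' U ('D_(delta_mx 0 a) f))
  else True.

Definition smooth_on U f : Prop := forall k, differentiable_upto k U f.

Lemma differentiable_upto_eq k U f g : open U -> (forall x, U x -> f x = g x) ->
  differentiable_upto k U f -> differentiable_upto k U g.
Proof.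
move=> oU; elim: k f g => [//|k IH] f g fg /= [df Df].
have nfg x : U x -> \forall y \near x, f y = g y.
  by move=> Ux; apply: filterS (open_nbhs_nbhs (conj oU Ux)) => y; exact: fg.
split=> [x Ux|a]; first exact: near_eq_differentiable (nfg x Ux) (df x Ux).
by apply: IH (Df a) => x Ux; apply: near_eq_derive; exact: nfg.
Qed.

Lemma differentiable_upto_cst k U (c : W) : open U ->
  differentiable_upto k U (cst c).
Proof.
move=> oU; elim: k c => [//|k IH] c /=; split=> [x _|a].
  exact: differentiable_cst.
by apply: (differentiable_upto_eq oU _ (IH 0)) => x _; rewrite derive_cst.
Qed.

Lemma differentiable_uptoD k U f g : open U -> differentiable_upto k U f ->
  differentiable_upto k U g -> differentiable_upto k U (f + g).
Proof.
move=> oU; elim: k f g => [//|k IH] f g /= [df Df] [dg Dg]; split=> [x Ux|a].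
  by apply: differentiableD; [exact: df|exact: dg].
apply: (differentiable_upto_eq oU _ (IH _ _ (Df a) (Dg a))) => x Ux.
by rewrite deriveD//; apply: diff_derivable; [exact: df|exact: dg].
Qed.

End Smooth.

Lemma differentiable_uptoS (R : realType) (m : nat) (W : normedModType R)
    k (U : set 'rV[R]_m) (f : 'rV[R]_m -> W) :
  differentiable_upto k.+1 U f -> differentiable_upto k U f.
Proof.
elim: k f => [//|k IH] f [df Df]; split=> // a; exact/IH/Df.
Qed.

Lemma differentiable_uptoM (R : realType) (m k : nat) (U : set 'rV[R]_m)
    (f g : 'rV[R]_m -> R) : open U -> differentiable_upto k U f ->
  differentiable_upto k U g -> differentiable_upto k U (f * g).
Proof.
move=> oU; elim: k f g => [//|k IH] f g df dg.
have df1 := differentiable_uptoS df; have dg1 := differentiable_uptoS dg.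
case: df dg => [df Df] [dg Dg]; split=> [x Ux|a].
  by apply: differentiableM; [exact: df|exact: dg].
have := differentiable_uptoD oU (IH _ _ df1 (Dg a)) (IH _ _ dg1 (Df a)).
apply: (differentiable_upto_eq oU) => x Ux.
by rewrite deriveM//; apply: diff_derivable; [exact: df|exact: dg].
Qed.

Section ComplexSmooth.
Variables (R : realType) (m : nat).
Implicit Types (U : set 'rV[R]_m) (f g : 'rV[R]_m -> R[i]).

Definition csmooth_on U f : Prop :=
  smooth_on U (fun x => complex.Re (f x) : R) /\
  smooth_on U (fun x => complex.Im (f x) : R).

Lemma csmooth_on_cst U (c : R[i]) : open U -> csmooth_on U (fun=> c).
Proof. by move=> oU; split=> k; exact: differentiable_upto_cst. Qed.

Lemma csmooth_onD U f g : open U -> csmooth_on U f -> csmooth_on U g ->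
  csmooth_on U (fun x => f x + g x).
Proof.
move=> oU [f1 f2] [g1 g2]; split=> k.
  apply: (differentiable_upto_eq oU _ (differentiable_uptoD oU (f1 k) (g1 k))).
  by move=> x _; rewrite !fctE; case: (f x) (g x) => [a b] [c d].
apply: (differentiable_upto_eq oU _ (differentiable_uptoD oU (f2 k) (g2 k))).
by move=> x _; rewrite !fctE; case: (f x) (g x) => [a b] [c d].
Qed.

Lemma csmooth_onM U f g : open U -> csmooth_on U f -> csmooth_on U g ->
  csmooth_on U (fun x => f x * g x).
Proof.
move=> oU [f1 f2] [g1 g2].
have N h k : differentiable_upto k U h ->
    differentiable_upto k U ((fun=> -1 : R) * h : _ -> R).
  by apply: differentiable_uptoM => //; exact: differentiable_upto_cst.
split=> k.
  have H := differentiable_uptoD oU (differentiable_uptoM oU (f1 k) (g1 k))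
    (N _ _ (differentiable_uptoM oU (f2 k) (g2 k))).
  apply: (differentiable_upto_eq oU _ H) => x _; rewrite !fctE.
  by case: (f x) (g x) => [a b] [c d] /=; rewrite mulN1r.
have H := differentiable_uptoD oU (differentiable_uptoM oU (f1 k) (g2 k))
  (differentiable_uptoM oU (f2 k) (g1 k)).
apply: (differentiable_upto_eq oU _ H) => x _; rewrite !fctE.
by case: (f x) (g x) => [a b] [c d].
Qed.

Lemma csmooth_on_conj U f : open U -> csmooth_on U f ->
  csmooth_on U (fun x => (f x)^*).
Proof.
move=> oU [f1 f2]; split=> k.
  by apply: (differentiable_upto_eq oU _ (f1 k)) => x _; case: (f x).
have H := differentiable_uptoM oU (differentiable_upto_cst k (-1 : R) oU) (f2 k).
apply: (differentiable_upto_eq oU _ H) => x _; rewrite !fctE.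
by case: (f x) => a b; rewrite mulN1r.
Qed.

Lemma csmooth_on_sum U (I : Type) (r : seq I) (F : I -> 'rV[R]_m -> R[i]) :
  open U -> (forall i, csmooth_on U (F i)) ->
  csmooth_on U (fun x => \sum_(i <- r) F i x).
Proof.
move=> oU sF; elim: r => [|i r IH].
  rewrite (_ : (fun x => _) = fun=> 0); first exact: csmooth_on_cst.
  by apply/funext => x; rewrite big_nil.
rewrite (_ : (fun x => _) = fun x => F i x + \sum_(i <- r) F i x).
  exact: csmooth_onD.
by apply/funext => x; rewrite big_cons.
Qed.

End ComplexSmooth.

Record manifold (R : realType) (m : nat) := Manifold {
  mspace :> topologicalType;
  manifold_hausdorff : hausdorff_space mspace;
  manifold_second_countable : @second_countable mspace;
  chart : Type;
  chart_dom : chart -> set mspace;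
  chart_coord : chart -> mspace -> 'rV[R]_m;
  chart_param : chart -> 'rV[R]_m -> mspace;
  dom_cover : forall p, exists i, chart_dom i p;
  dom_open : forall i, open (chart_dom i);
  img_open : forall i, open (chart_coord i @` chart_dom i);
  coordK : forall i p, chart_dom i p -> chart_param i (chart_coord i p) = p;
  coord_continuous : forall i p, chart_dom i p ->
    {for p, continuous (chart_coord i)};
  param_continuous : forall i x, (chart_coord i @` chart_dom i) x ->
    {for x, continuous (chart_param i)};
  transition_smooth : forall i j,
    smooth_on (chart_coord i @` (chart_dom i `&` chart_dom j))
              (chart_coord j \o chart_param i)
}.
Arguments chart {R m} _.
Arguments chart_dom {R m _}.
Arguments chart_coord {R m _}.
Arguments chart_param {R m _}.

Section Tangent.
Variables (R : realType) (m : nat) (M : manifold R m).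
Implicit Types (i j k : chart M) (p : M).

Definition transition i j p : 'M[R]_m :=
  jacobian (chart_coord j \o chart_param i) (chart_coord i p).

Lemma overlap_open i j : open (chart_coord i @` (chart_dom i `&` chart_dom j)).
Proof.
rewrite openE => _ [p [ip jp] <-].
have pi : (chart_coord i @` chart_dom i) (chart_coord i p) by exists p.
have c := param_continuous pi; have := c (chart_dom j).
rewrite coordK// => /(_ (open_nbhs_nbhs (conj (@dom_open _ _ M j) jp))) jn.
have iN : nbhs (chart_coord i p) (chart_coord i @` chart_dom i).
  by apply: open_nbhs_nbhs; split => //; exact: img_open.
rewrite /interior; apply: filterS2 iN jn => _ [q iq <-] /=.
by rewrite coordK// => jq; exists q.
Qed.

Lemma transition_differentiable i j p : chart_dom i p -> chart_dom j p ->
  differentiable (chart_coord j \o chart_param i) (chart_coord i p).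
Proof. by move=> ip jp; have [+ _] := @transition_smooth _ _ M i j 1; apply; exists p. Qed.

Lemma transition_comp i j k p (u : 'rV[R]_m) : chart_dom i p -> chart_dom j p -> chart_dom k p ->
  u *m transition i j p *m transition j k p = u *m transition i k p.
Proof.
move=> ip jp kp.
have ij := transition_differentiable ip jp.
have jk := transition_differentiable jp kp.
have ik := transition_differentiable ip kp.
have pE : (chart_coord j \o chart_param i) (chart_coord i p) = chart_coord j p by rewrite /= coordK.
have jk' : differentiable (chart_coord k \o chart_param j) ((chart_coord j \o chart_param i) (chart_coord i p)).
  by rewrite pE.
have N : \forall x \near chart_coord i p, (chart_coord k \o chart_param i) x =
    ((chart_coord k \o chart_param j) \o (chart_coord j \o chart_param i)) x.
  have : nbhs (chart_coord i p) (chart_coord i @` (chart_dom i `&` chart_dom j)).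
    by apply: open_nbhs_nbhs; split; [exact: overlap_open|exists p].
  by apply: filterS => _ [q [iq jq] <-] /=; rewrite !coordK.
have E1 := near_eq_jacobian u N ik.
have E2 := jacobian_comp u ij jk'.
rewrite pE in E2.
exact (etrans (esym E2) (esym E1)).
Qed.

(* A tangent vector at [p] is the family of its components in all charts around
   [p], related by the Jacobian matrices of the transition maps (acting on
   rows). The components in the charts that do not contain [p] are set to 0, as
   they carry no information. *)
Record tangent p := Tangent {
  component :> chart M -> 'rV[R]_m;
  component_transition : forall i j, chart_dom i p -> chart_dom j p ->
    component j = component i *m transition i j p;
  component_out : forall i, ~ chart_dom i p -> component i = 0
}.

Lemma tangent_eq p (v w : tangent p) : (forall i, v i = w i) -> v = w.
Proof.
case: v w => [v v1 v2] [w w1 w2] /= /funext E; case: w / E in w1 w2 *.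
by congr Tangent; exact: Prop_irrelevance.
Qed.

HB.instance Definition _ p := gen_eqMixin (tangent p).
HB.instance Definition _ p := gen_choiceMixin (tangent p).

Program Definition tangent_zero p : tangent p := @Tangent p (fun=> 0) _ _.
Next Obligation. by move=> p i j _ _; rewrite mul0mx. Qed.
Next Obligation. by []. Qed.

Program Definition tangent_opp p (v : tangent p) : tangent p :=
  @Tangent p (fun i => - v i) _ _.
Next Obligation.
move=> p v i j ip jp /=; rewrite (component_transition v ip jp).
by rewrite mulNmx.
Qed.
Next Obligation. by move=> p v i np /=; rewrite component_out// oppr0. Qed.

Program Definition tangent_add p (v w : tangent p) : tangent p :=
  @Tangent p (fun i => v i + w i) _ _.
Next Obligation.
move=> p v w i j ip jp /=; rewrite (component_transition v ip jp).
by rewrite (component_transition w ip jp) mulmxDl.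
Qed.
Next Obligation. by move=> p v w i np /=; rewrite !component_out// addr0. Qed.

Program Definition tangent_scale p (a : R) (v : tangent p) : tangent p :=
  @Tangent p (fun i => a *: v i) _ _.
Next Obligation.
move=> p a v i j ip jp /=; rewrite (component_transition v ip jp).
by rewrite scalemxAl.
Qed.
Next Obligation. by move=> p a v i np /=; rewrite component_out// scaler0. Qed.

Program Definition tangent_isZmodule p := @GRing.isZmodule.Build (tangent p)
  (tangent_zero p) (@tangent_opp p) (@tangent_add p) _ _ _ _.
Next Obligation. by move=> p u v w; apply: tangent_eq => i /=; rewrite addrA. Qed.
Next Obligation. by move=> p u v; apply: tangent_eq => i /=; rewrite addrC. Qed.
Next Obligation. by move=> p u; apply: tangent_eq => i /=; rewrite add0r. Qed.
Next Obligation. by move=> p u; apply: tangent_eq => i /=; rewrite addNr. Qed.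
HB.instance Definition _ p := tangent_isZmodule p.

Program Definition tangent_isLmodule p :=
  @GRing.Zmodule_isLmodule.Build R (tangent p) (@tangent_scale p) _ _ _ _.
Next Obligation. by move=> p a b u; apply: tangent_eq => i /=; rewrite scalerA. Qed.
Next Obligation. by move=> p u; apply: tangent_eq => i /=; rewrite scale1r. Qed.
Next Obligation. by move=> p a u v; apply: tangent_eq => i /=; rewrite scalerDr. Qed.
Next Obligation. by move=> p u a b; apply: tangent_eq => i /=; rewrite scalerDl. Qed.
HB.instance Definition _ p := tangent_isLmodule p.

(* The tangent vector at [p] with components [u] in the chart [i]; it is 0 if
   [p] is not in the domain of [i]. *)
Program Definition tangent_of_chart i p (u : 'rV[R]_m) : tangent p :=
  @Tangent p (fun j => if `[< chart_dom i p /\ chart_dom j p >]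
                       then u *m transition i j p else 0) _ _.
Next Obligation.
move=> i p u j k jp kp /=.
case: (asboolP (chart_dom i p /\ chart_dom k p)) => [[ip _]|nk];
  case: (asboolP (chart_dom i p /\ chart_dom j p)) => [[ip' _]|nj].
- exact (esym (transition_comp u ip jp kp)).
- by case: nj.
- by case: nk.
- by rewrite mul0mx.
Qed.
Next Obligation. by move=> i p u j nj /=; case: asboolP => // -[]. Qed.

Definition coordinate_vector i (a : 'I_m) p : tangent p :=
  tangent_of_chart i p (delta_mx 0 a).

End Tangent.

Section SmoothFunctions.
Variables (R : realType) (m : nat) (M : manifold R m).

Definition smooth_fun (f : M -> R[i]) : Prop :=
  forall i : chart M,
    csmooth_on (chart_coord i @` chart_dom i) (f \o chart_param i).

Record Cinfty := SmoothFunction {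
  cinf_val :> M -> R[i];
  cinf_smooth : smooth_fun cinf_val
}.
Implicit Types f g h : Cinfty.

Lemma cinf_eq f g : (forall p, f p = g p) -> f = g.
Proof.
case: f g => [f f1] [g g1] /= /funext E; case: g / E in g1 *.
by congr SmoothFunction; exact: Prop_irrelevance.
Qed.

HB.instance Definition _ := gen_eqMixin Cinfty.
HB.instance Definition _ := gen_choiceMixin Cinfty.

Program Definition cinf_cst (c : R[i]) : Cinfty :=
  @SmoothFunction (fun=> c) _.
Next Obligation. by move=> c i; apply: csmooth_on_cst; exact: img_open. Qed.

Program Definition cinf_add f g : Cinfty :=
  @SmoothFunction (fun p => f p + g p) _.
Next Obligation.
by move=> f g i; apply: csmooth_onD (cinf_smooth f i) (cinf_smooth g i);
   exact: img_open.
Qed.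

Program Definition cinf_mul f g : Cinfty :=
  @SmoothFunction (fun p => f p * g p) _.
Next Obligation.
by move=> f g i; apply: csmooth_onM (cinf_smooth f i) (cinf_smooth g i);
   exact: img_open.
Qed.

Program Definition cinf_conj f : Cinfty :=
  @SmoothFunction (fun p => (f p)^*) _.
Next Obligation.
by move=> f i; apply: csmooth_on_conj (cinf_smooth f i); exact: img_open.
Qed.

Program Definition cinf_isZmodule := @GRing.isZmodule.Build Cinfty
  (cinf_cst 0) (fun f => cinf_mul (cinf_cst (-1)) f) cinf_add _ _ _ _.
Next Obligation. by move=> f g h; apply: cinf_eq => p /=; rewrite addrA. Qed.
Next Obligation. by move=> f g; apply: cinf_eq => p /=; rewrite addrC. Qed.
Next Obligation. by move=> f; apply: cinf_eq => p /=; rewrite add0r. Qed.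
Next Obligation. by move=> f; apply: cinf_eq => p /=; rewrite mulN1r addNr. Qed.
HB.instance Definition _ := cinf_isZmodule.

Program Definition cinf_isLmodule := @GRing.Zmodule_isLmodule.Build R[i] Cinfty
  (fun z f => cinf_mul (cinf_cst z) f) _ _ _ _.
Next Obligation. by move=> z w f; apply: cinf_eq => p /=; rewrite mulrA. Qed.
Next Obligation. by move=> f; apply: cinf_eq => p /=; rewrite mul1r. Qed.
Next Obligation. by move=> z f g; apply: cinf_eq => p /=; rewrite mulrDr. Qed.
Next Obligation. by move=> f z w; apply: cinf_eq => p /=; rewrite mulrDl. Qed.
HB.instance Definition _ := cinf_isLmodule.

Program Definition cinf_isStarAlgebra := @isStarAlgebra.Build R[i] Cinfty
  cinf_mul _ _ _ cinf_conj _ _ _.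
Next Obligation. by move=> f g h; apply: cinf_eq => p /=; rewrite mulrA. Qed.
Next Obligation.
by move=> f z g h; apply: cinf_eq => p /=; rewrite mulrDl mulrA.
Qed.
Next Obligation.
by move=> f z g h; apply: cinf_eq => p /=; rewrite mulrDr mulrCA.
Qed.
Next Obligation.
by move=> z f g; apply: cinf_eq => p /=; rewrite rmorphD rmorphM.
Qed.
Next Obligation.
by move=> f g; apply: cinf_eq => p /=; rewrite rmorphM mulrC.
Qed.
Next Obligation. by move=> f; apply: cinf_eq => p /=; exact: conjCK. Qed.
HB.instance Definition _ := cinf_isStarAlgebra.

End SmoothFunctions.

(* The k-th exterior power of the dual of [V], tensored with [R[i]], is the
   space of alternating real-multilinear maps from [V^k] to [R[i]]. A function
   on lists of vectors gathers the components of all degrees; if [V] has finite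
   dimension, the components of degree larger than the dimension vanish and
   this is the whole exterior algebra. *)
Section Exterior.
Variables (R : realType) (V : lmodType R).
Implicit Types (al be ga : seq V -> R[i]) (s t : seq V) (v w : V).

Definition multilinear al : Prop := forall s t (a : R) v w,
  al (s ++ (a *: v + w) :: t) =
  (a%:C)%C * al (s ++ v :: t) + al (s ++ w :: t).

Definition alternating al : Prop := forall s t t' v,
  al (s ++ v :: t ++ v :: t') = 0.

Fixpoint inversions (b : bitseq) : nat :=
  if b is x :: b' then (if x then 0 else count id b') + inversions b' else 0.

(* The sum over all (k,l)-shuffles, for all k + l = size s, of
   sign * al (v_i, i selected by b) * be (v_i, i not selected by b);
   [inversions b] is the number of pairs i < j with i not selected and j
   selected. *)
Definition wedge_at al be s : R[i] :=
  \sum_(b : (size s).-tuple bool)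
    (-1) ^+ inversions b * (al (mask b s) * be (mask (map negb b) s)).

(* The reversal of the arguments accounts for the reversal of the order of the
   factors in a product of one-forms. *)
Definition form_star al s : R[i] := (al (rev s))^*.

Let contract v al s := al (v :: s).
Let contractr v al s := al (rcons s v).
Let hat al s : R[i] := (-1) ^+ size s * al s.

Lemma wedge_nil al be : wedge_at al be [::] = al [::] * be [::].
Proof.
rewrite /wedge_at (bigD1 [tuple])//= big1 ?addr0 ?mul1r ?expr0 ?mul1r// => b.
by rewrite tuple0.
Qed.

Lemma big_tuple_cons n (F : n.+1.-tuple bool -> R[i]) :
  \sum_(b : n.+1.-tuple bool) F b = \sum_(b : n.-tuple bool)
    (F [tuple of true :: b] + F [tuple of false :: b]).
Proof.
rewrite big_split /=.
rewrite (reindex (fun u : bool * n.-tuple bool => [tuple of u.1 :: u.2])) /=.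
  rewrite -(pair_big xpredT xpredT (fun (x : bool) (b : n.-tuple bool) => F [tuple of x :: b])) /=.
  by rewrite big_bool.
exists (fun b : n.+1.-tuple bool => (thead b, [tuple of behead b])).
  by move=> [x b] _ /=; congr pair; apply: val_inj.
by move=> b _; rewrite /= -tuple_eta.
Qed.

Lemma wedge_cons al be v s : wedge_at al be (v :: s) =
  wedge_at (contract v al) be s + wedge_at (hat al) (contract v be) s.
Proof.
rewrite /wedge_at big_tuple_cons big_split /=; congr (_ + _).
apply: eq_bigr => b _; rewrite /contract /hat size_mask ?size_tuple//.
by rewrite exprD -!mulrA mulrCA.
Qed.

Lemma wedgeP z al al' be s :
  wedge_at (fun t => z * al t + al' t) be s = z * wedge_at al be s + wedge_at al' be s.
Proof.
rewrite /wedge_at mulr_sumr -big_split; apply: eq_bigr => b _ /=.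
by rewrite mulrDl mulrDr; congr (_ + _); rewrite -!mulrA mulrCA.
Qed.

Lemma wedgePr z al be be' s :
  wedge_at al (fun t => z * be t + be' t) s = z * wedge_at al be s + wedge_at al be' s.
Proof.
rewrite /wedge_at mulr_sumr -big_split; apply: eq_bigr => b _ /=.
by rewrite !mulrDr; congr (_ + _); rewrite !(mulrCA _ z).
Qed.

Lemma eq_wedge al al' be be' : al =1 al' -> be =1 be' ->
  wedge_at al be =1 wedge_at al' be'.
Proof. by move=> /funext -> /funext ->. Qed.

Lemma wedgeD al al' be s :
  wedge_at (fun t => al t + al' t) be s = wedge_at al be s + wedge_at al' be s.
Proof.
rewrite -[wedge_at al be s]mul1r -wedgeP.
by apply: eq_wedge => // t; rewrite mul1r.
Qed.

Lemma wedge0l be s : wedge_at (fun=> 0) be s = 0.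
Proof. by rewrite /wedge_at big1// => b _; rewrite mul0r mulr0. Qed.

Lemma wedge0r al s : wedge_at al (fun=> 0) s = 0.
Proof. by rewrite /wedge_at big1// => b _; rewrite !mulr0. Qed.

Lemma wedgeNl al be s : wedge_at (fun t => - al t) be s = - wedge_at al be s.
Proof.
rewrite -[RHS]addr0 -mulN1r -(wedge0l be s) -wedgeP.
by apply: eq_wedge => // t; rewrite mulN1r addr0.
Qed.

Lemma wedgeNr al be s : wedge_at al (fun t => - be t) s = - wedge_at al be s.
Proof.
rewrite -[RHS]addr0 -mulN1r -(wedge0r al s) -wedgePr.
by apply: eq_wedge => // t; rewrite mulN1r addr0.
Qed.

Lemma hat_wedge al be s : hat (wedge_at al be) s = wedge_at (hat al) (hat be) s.
Proof.
rewrite /hat /wedge_at mulr_sumr; apply: eq_bigr => b _.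
have bs : size b = size s by rewrite size_tuple.
rewrite !size_mask ?size_map// mulrCA; congr (_ * _).
rewrite mulrACA -exprD count_map; congr (_ ^+ _ * _).
rewrite -{1}bs; move: (tval b) => c; rewrite -(count_predC id c).
by congr (_ + _)%N; apply: eq_count => -[].
Qed.

Lemma wedgeA al be ga s : wedge_at al (wedge_at be ga) s = wedge_at (wedge_at al be) ga s.
Proof.
elim: s al be ga => [|v s IH] al be ga; first by rewrite !wedge_nil mulrA.
rewrite !wedge_cons IH.
have -> : contract v (wedge_at be ga) = (fun t =>
    wedge_at (contract v be) ga t + wedge_at (hat be) (contract v ga) t).
  by apply/funext => t; exact: wedge_cons.
have -> : contract v (wedge_at al be) = (fun t =>
    wedge_at (contract v al) be t + wedge_at (hat al) (contract v be) t).
  by apply/funext => t; exact: wedge_cons.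
rewrite wedgeD -addrA; congr (_ + _).
rewrite -[wedge_at _ (fun _ => _ + _) s]/(wedge_at (hat al) (fun t => _) s).
have -> : (fun t => wedge_at (contract v be) ga t + wedge_at (hat be) (contract v ga) t)
  = (fun t => 1 * wedge_at (contract v be) ga t + wedge_at (hat be) (contract v ga) t).
  by apply/funext => t; rewrite mul1r.
rewrite wedgePr mul1r !IH; congr (_ + _).
by apply: eq_wedge => // t; rewrite hat_wedge.
Qed.

Lemma wedge_rcons al be v s : wedge_at al be (rcons s v) =
  wedge_at al (contractr v be) s + wedge_at (contractr v al) (hat be) s.
Proof.
have hc u ga : contract u (hat ga) = (fun t => - hat (contract u ga) t).
  by apply/funext => t; rewrite /contract /hat /= exprS mulN1r mulNr.
have hr u ga : contractr u (hat ga) = (fun t => - hat (contractr u ga) t).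
  apply/funext => t.
  by rewrite /contractr /hat size_rcons exprS mulN1r mulNr.
elim: s al be => [|u s IH] al be.
  by rewrite wedge_cons !wedge_nil /hat /contract /contractr /= !expr0 !mul1r addrC.
rewrite rcons_cons !wedge_cons !IH hr hc.
by rewrite wedgeNl wedgeNr addrACA.
Qed.

Lemma form_star_wedge al be s :
  form_star (wedge_at al be) s = wedge_at (form_star be) (form_star al) s.
Proof.
rewrite /form_star; elim: s al be => [|v s IH] al be.
  by rewrite !wedge_nil /= rmorphM mulrC.
rewrite rev_cons wedge_rcons rmorphD /= !IH wedge_cons; congr (_ + _).
  by apply: eq_wedge => t; rewrite /contract /contractr ?rev_cons.
apply: eq_wedge => t; last by rewrite /contract /contractr ?rev_cons.
by rewrite /hat rmorphM rmorph_sign size_rev.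
Qed.

Lemma multilinear_contract v al : multilinear al -> multilinear (contract v al).
Proof. by move=> mal s t a u w; exact: (mal (v :: s)). Qed.

Lemma multilinear_hat al : multilinear al -> multilinear (hat al).
Proof.
move=> mal s t a u w; rewrite /hat mal !size_cat /= mulrDr.
by congr (_ + _); rewrite mulrCA.
Qed.

Lemma multilinear_wedge al be : multilinear al -> multilinear be ->
  multilinear (wedge_at al be).
Proof.
move=> mal mbe s; elim: s al be mal mbe => [|v s IH] al be mal mbe t a u w.
  rewrite /= !wedge_cons.
  rewrite (eq_wedge (al' := fun t => (a%:C)%C * contract u al t + contract w al t)
    (be' := be) _ _ t) //; last by move=> x; exact: (mal [::]).
  rewrite wedgeP (eq_wedge (al' := hat al) (al := hat al)
    (be' := fun t => (a%:C)%C * contract u be t + contract w be t) _ _ t) //.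
    by rewrite wedgePr mulrDr addrACA.
  by move=> x; exact: (mbe [::]).
rewrite !cat_cons !wedge_cons.
rewrite (IH _ _ (multilinear_contract v mal) mbe).
rewrite (IH _ _ (multilinear_hat mal) (multilinear_contract v mbe)).
by rewrite mulrDr addrACA.
Qed.

Lemma multilinear_star al : multilinear al -> multilinear (form_star al).
Proof.
move=> mal s t a u w; rewrite /form_star !rev_cat !rev_cons !cat_rcons mal.
by rewrite rmorphD rmorphM; congr (_ * _ + _); rewrite /=; simpc.
Qed.

Definition alternating_adjacent al : Prop := forall s t v,
  al (s ++ v :: v :: t) = 0.

Lemma multilinearD al s t v w : multilinear al ->
  al (s ++ (v + w) :: t) = al (s ++ v :: t) + al (s ++ w :: t).
Proof. by move=> mal; rewrite -[v]scale1r mal scale1r mul1r. Qed.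

Lemma alternatingP al : multilinear al ->
  alternating_adjacent al -> alternating al.
Proof.
move=> mal aal s t t' v; elim: t s => [|w t IH] s; first exact: aal.
have := aal s (t ++ v :: t') (v + w).
have mD x y s1 t1 := multilinearD s1 t1 x y mal.
rewrite mD -(cat_rcons v s) -(cat_rcons w s) !mD !cat_rcons !aal add0r addr0.
move=> /eqP; rewrite addr_eq0 => /eqP E.
have := IH (rcons s w); rewrite cat_rcons => H.
by rewrite cat_cons E H oppr0.
Qed.

Lemma alternating_wedge al be : multilinear al -> multilinear be ->
  alternating al -> alternating be -> alternating (wedge_at al be).
Proof.
move=> mal mbe aal abe; apply: alternatingP; first exact: multilinear_wedge.
have {}aal : alternating_adjacent al by move=> s t v; exact: (aal s [::]).
have {}abe : alternating_adjacent be by move=> s t v; exact: (abe s [::]).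
move=> s; elim: s al be aal abe {mal mbe} => [|w s IH] al be aal abe t v.
  rewrite /= !wedge_cons.
  have -> : contract v (contract v al) = fun=> 0.
    by apply/funext => x; exact: (aal [::]).
  have -> : contract v (contract v be) = fun=> 0.
    by apply/funext => x; exact: (abe [::]).
  rewrite wedge0l wedge0r add0r addr0.
  rewrite -[X in _ + X](eq_wedge (al := fun t => - hat (contract v al) t)
    (be := contract v be)) // ?wedgeNl ?subrr//.
  by move=> x; rewrite /contract /hat /= exprS mulN1r mulNr.
rewrite cat_cons wedge_cons !IH ?addr0//.
- by move=> x y z; rewrite /hat aal mulr0.
- by move=> x y z; exact: (abe (w :: x)).
- by move=> x y z; exact: (aal (w :: x)).
Qed.

Lemma alternating_star al : alternating al -> alternating (form_star al).
Proof.
move=> aal s t t' v; rewrite /form_star !(rev_cat, rev_cons) -!cats1 -!catA.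
by rewrite aal conjC0.
Qed.

End Exterior.

Section Forms.
Variables (R : realType) (m : nat) (M : manifold R m).

(* Smoothness is smoothness of the coefficients in all charts. *)
Definition smooth_form (al : forall p : M, seq (tangent p) -> R[i]) : Prop :=
  forall (i : chart M) (J : seq 'I_m), csmooth_on (chart_coord i @` chart_dom i)
    (fun x => al (chart_param i x)
                 [seq coordinate_vector i a (chart_param i x) | a <- J]).

Record diff_form := Form {
  form_at :> forall p : M, seq (tangent p) -> R[i];
  form_multilinear : forall p, multilinear (@form_at p);
  form_alternating : forall p, alternating (@form_at p);
  form_smooth : smooth_form (@form_at)
}.
Implicit Types al be ga : diff_form.

Lemma form_eq al be : (forall p, al p =1 be p) -> al = be.
Proof.
case: al be => [al a1 a2 a3] [be b1 b2 b3] /= E.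
have {}E : al = be by apply: functional_extensionality_dep => p; exact/funext/E.
by case: be / E in b1 b2 b3 *; congr Form; exact: Prop_irrelevance.
Qed.

HB.instance Definition _ := gen_eqMixin diff_form.
HB.instance Definition _ := gen_choiceMixin diff_form.

Definition degree_zero (f : M -> R[i]) (p : M) (s : seq (tangent p)) : R[i] :=
  if s is [::] then f p else 0.

Program Definition form_of_fun (f : Cinfty M) : diff_form :=
  @Form (degree_zero f) _ _ _.
Next Obligation.
by move=> f p [|u s] t a v w /=; rewrite mulr0 addr0.
Qed.
Next Obligation. by move=> f p [|u s] t t' v. Qed.
Next Obligation.
move=> f i [|a J] /=; first exact: cinf_smooth f i.
by apply: csmooth_on_cst; exact: img_open.
Qed.

Program Definition form_add al be : diff_form :=
  @Form (fun p s => al p s + be p s) _ _ _.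
Next Obligation.
by move=> al be p s t a v w; rewrite !form_multilinear mulrDr addrACA.
Qed.
Next Obligation.
by move=> al be p s t t' v; rewrite !form_alternating addr0.
Qed.
Next Obligation.
move=> al be i J.
by apply: csmooth_onD (form_smooth al i J) (form_smooth be i J);
   exact: img_open.
Qed.

Program Definition form_scale (z : R[i]) al : diff_form :=
  @Form (fun p s => z * al p s) _ _ _.
Next Obligation.
by move=> z al p s t a v w; rewrite form_multilinear mulrDr mulrCA.
Qed.
Next Obligation.
by move=> z al p s t t' v; rewrite form_alternating mulr0.
Qed.
Next Obligation.
move=> z al i J; have oU := @img_open _ _ M i.
exact: csmooth_onM oU (csmooth_on_cst z oU) (form_smooth al i J).
Qed.

Program Definition form_wedge al be : diff_form :=
  @Form (fun p => wedge_at (al p) (be p)) _ _ _.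
Next Obligation.
by move=> al be p; apply: multilinear_wedge; exact: form_multilinear.
Qed.
Next Obligation.
by move=> al be p; apply: alternating_wedge;
   first [exact: form_multilinear|exact: form_alternating].
Qed.
Next Obligation.
move=> al be i J; have oU := @img_open _ _ M i.
have -> : (fun x => wedge_at (al (chart_param i x)) (be (chart_param i x))
      [seq coordinate_vector i a (chart_param i x) | a <- J]) =
    (fun x => \sum_(b : (size J).-tuple bool) (-1) ^+ inversions b *
      (al (chart_param i x)
          [seq coordinate_vector i a (chart_param i x) | a <- mask b J] *
       be (chart_param i x)
          [seq coordinate_vector i a (chart_param i x) | a <- mask (map negb b) J])).
  apply/funext => x; rewrite /wedge_at size_map; apply: eq_bigr => b _.
  by rewrite !map_mask.
apply: csmooth_on_sum => // b.
apply: csmooth_onM (csmooth_on_cst _ oU) _ => //.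
exact: csmooth_onM oU (form_smooth al i _) (form_smooth be i _).
Qed.

Program Definition form_conj al : diff_form :=
  @Form (fun p => form_star (al p)) _ _ _.
Next Obligation. by move=> al p; exact/multilinear_star/form_multilinear. Qed.
Next Obligation. by move=> al p; exact/alternating_star/form_alternating. Qed.
Next Obligation.
move=> al i J; rewrite /form_star; apply: csmooth_on_conj; first exact: img_open.
rewrite (_ : (fun x => _) = (fun x => al (chart_param i x)
    [seq coordinate_vector i a (chart_param i x) | a <- rev J])).
  exact: form_smooth.
by apply/funext => x; rewrite map_rev.
Qed.

Program Definition form_isZmodule := @GRing.isZmodule.Build diff_form
  (form_of_fun 0) (form_scale (-1)) form_add _ _ _ _.
Next Obligation. by move=> x y z; apply: form_eq => p s /=; rewrite addrA. Qed.
Next Obligation. by move=> x y; apply: form_eq => p s /=; rewrite addrC. Qed.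
Next Obligation.
by move=> x; apply: form_eq => p [|u s] /=; rewrite add0r.
Qed.
Next Obligation.
by move=> x; apply: form_eq => p [|u s] /=; rewrite mulN1r addNr.
Qed.
HB.instance Definition _ := form_isZmodule.

Program Definition form_isLmodule := @GRing.Zmodule_isLmodule.Build R[i] diff_form
  form_scale _ _ _ _.
Next Obligation. by move=> z w x; apply: form_eq => p s /=; rewrite mulrA. Qed.
Next Obligation. by move=> x; apply: form_eq => p s /=; rewrite mul1r. Qed.
Next Obligation. by move=> z x y; apply: form_eq => p s /=; rewrite mulrDr. Qed.
Next Obligation. by move=> x z w; apply: form_eq => p s /=; rewrite mulrDl. Qed.
HB.instance Definition _ := form_isLmodule.

Program Definition form_isStarAlgebra := @isStarAlgebra.Build R[i] diff_form
  form_wedge _ _ _ form_conj _ _ _.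
Next Obligation. by move=> x y z; apply: form_eq => p s; exact: wedgeA. Qed.
Next Obligation. by move=> x z y w; apply: form_eq => p s; exact: wedgeP. Qed.
Next Obligation. by move=> x z y w; apply: form_eq => p s; exact: wedgePr. Qed.
Next Obligation.
by move=> z x y; apply: form_eq => p s; rewrite /= /form_star rmorphD rmorphM.
Qed.
Next Obligation.
by move=> x y; apply: form_eq => p s; exact: form_star_wedge.
Qed.
Next Obligation.
by move=> x; apply: form_eq => p s; rewrite /= /form_star revK conjCK.
Qed.
HB.instance Definition _ := form_isStarAlgebra.

Definition positive_degree : set diff_form :=
  [set al | forall p, al p [::] = 0].

End Forms.
Arguments positive_degree {R m} M.

(* Main.v *)
(* A form of positive degree is nilpotent, and a Hermitian nilpotent operator on
   a pre-Hilbert space vanishes because [a^* a x = a^2 x = 0] forces [a x = 0];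
   so every representation kills the forms of positive degree and factors
   through the degree-zero part. The point evaluations show that nothing more is
   killed by all representations.

   For the failure of Morita equivalence, let [X] be an equivalence bimodule and
   [al] a form of positive degree. Squaring the function [b = <x al, y>] gives
   [b^2 = <x (al <y, x> al), y>], of the same shape but of higher degree, so [b]
   is nilpotent and hence 0. Fullness then yields [al = 0], whereas the product
   of a coordinate one-form with a bump function is a nonzero form. *)
Require Import Defs.
From HB Require Import structures.
From mathcomp Require Import all_boot all_order all_algebra.
From mathcomp Require Import all_classical all_reals all_analysis.
From mathcomp Require Import complex ring lra.

Set Implicit Arguments.
Unset Strict Implicit.
Unset Printing Implicit Defensive.

Import Order.TTheory GRing.Theory Num.Theory.
Import numFieldNormedType.Exports.
Local Open Scope classical_set_scope.
Local Open Scope ring_scope.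

(** * Maps satisfying the predicate [linear] *)

Section LinearMaps.
Variables (K : pzRingType) (U V : lmodType K) (f : U -> V).
Hypothesis lf : linear f.

Lemma linear_map0 : f 0 = 0.
Proof. by have := lf (-1) 0 0; rewrite scaler0 addr0 scaleN1r addNr. Qed.

Lemma linear_map_sum n (z : 'I_n -> K) (x : 'I_n -> U) :
  f (\sum_(i < n) z i *: x i) = \sum_(i < n) z i *: f (x i).
Proof.
elim: n z x => [|n IH] z x; first by rewrite !big_ord0 linear_map0.
by rewrite !big_ord_recl lf IH.
Qed.

End LinearMaps.

(** * Hermitian elements and their nilpotency under representations *)

Section StarAlgebra.
Variables (C : numClosedFieldType) (A : starAlgType C).
Implicit Types a b : A.

Lemma starD a b : star (a + b) = star a + star b.
Proof. by rewrite -[a]scale1r starP rmorph1 !scale1r. Qed.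

Lemma star0 : star (0 : A) = 0.
Proof. by apply: (addrI (star 0)); rewrite -starD !addr0. Qed.

Lemma starZ (z : C) a : star (z *: a) = z^* *: star a.
Proof. by rewrite -[z *: a]addr0 starP star0 addr0. Qed.

(** Without a unit, powers are taken by iterated squaring: [iter n asqr a] is the power of exponent
    [2 ^ n], again Hermitian if [a] is. *)
Definition asqr a : A := a ** a.

Definition real_part a : A := 2^-1 *: (a + star a).
Definition imaginary_part a : A := (2 * 'i)^-1 *: (a - star a).

Lemma cartesian_decomposition a : a = real_part a + 'i *: imaginary_part a.
Proof.
rewrite /real_part /imaginary_part scalerA invfM mulrCA divff ?neq0Ci// mulr1.
rewrite -scalerDr addrACA subrr addr0.
have -> : a + a = 2 *: a by rewrite scaler_nat mulr2n.
by rewrite scalerA mulVf ?scale1r ?pnatr_eq0.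
Qed.

Lemma real_part_star a : star (real_part a) = real_part a.
Proof.
by rewrite /real_part starZ starD starK addrC fmorphV rmorph_nat.
Qed.

Lemma imaginary_part_star a : star (imaginary_part a) = imaginary_part a.
Proof.
have -> : imaginary_part a = (2 * 'i)^-1 *: (a - star a) by [].
have E : star (a - star a) = - (a - star a).
  by rewrite starD -[- star a]scaleN1r starZ starK rmorphN1 !scaleN1r opprB.
(* Conjugation changes the sign of ['i], which cancels the sign in [E]. *)
rewrite starZ E fmorphV rmorphM rmorph_nat /= conjCi mulrN invrN.
by rewrite scaleNr scalerN opprK.
Qed.

Variable pi : starRep A.

Lemma hip0r (x : pi) : hip x 0 = 0.
Proof. exact: (@linear_map0 _ _ C^o (hip x) (hip_linear x)). Qed.

Lemma hip_eq0 (x : pi) : hip x x = 0 -> x = 0.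
Proof.
by move=> xx; apply/eqP; apply: contraTT isT => /hip_posdef; rewrite xx ltxx.
Qed.

Lemma repD a b (x : pi) : rep_op (a + b) x = rep_op a x + rep_op b x.
Proof. by rewrite -[a]scale1r repP !scale1r. Qed.

Lemma rep0 (x : pi) : rep_op 0 x = 0.
Proof. by apply: (addrI (rep_op 0 x)); rewrite -repD !addr0. Qed.

Lemma repZ (z : C) a (x : pi) : rep_op (z *: a) x = z *: rep_op a x.
Proof. by rewrite -[z *: a]addr0 repP rep0 addr0. Qed.

Lemma rep_kernel_asqr a : star a = a ->
  rep_kernel pi (asqr a) -> rep_kernel pi a.
Proof.
move=> aE ka x; apply: hip_eq0; rewrite rep_star aE -repM.
by rewrite -/(asqr a) ka hip0r.
Qed.

(** The innermost squaring is split off: induction handles the Hermitian element [asqr a], and the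
    previous lemma descends to [a]. *)
Lemma rep_kernel_nilpotent n a : star a = a -> iter n asqr a = 0 ->
  rep_kernel pi a.
Proof.
elim: n a => [|n IH] a aE.
  by move=> /= -> x; rewrite rep0.
rewrite iterSr => a0; apply: rep_kernel_asqr => //; apply: IH => //.
by rewrite /asqr starM aE.
Qed.

End StarAlgebra.

(** * Pullback of representations and equivalence of representation categories *)

Section Hom.
Variables (C : numClosedFieldType).

Record starHom (A B : starAlgType C) := StarHom {
  star_hom :> A -> B;
  star_hom_linear : linear star_hom;
  star_homM : forall a b, star_hom (a ** b) = star_hom a ** star_hom b;
  star_hom_star : forall a, star_hom (star a) = star (star_hom a)
}.

Section Pullback.
Variables (A B : starAlgType C) (h : starHom A B).

Program Definition pullback (pi : starRep B) : starRep A :=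
  @StarRep C A pi (fun a => rep_op (h a)) _ _ _ _.
Next Obligation. by move=> pi a z x y; exact: rep_linear. Qed.
Next Obligation. by move=> pi a x y /=; rewrite rep_star star_hom_star. Qed.
Next Obligation. by move=> pi z a b x /=; rewrite star_hom_linear repP. Qed.
Next Obligation. by move=> pi a b x /=; rewrite star_homM repM. Qed.

Program Definition pullback_hom (pi rho : starRep B) (f : intertwiner pi rho) :
    intertwiner (pullback pi) (pullback rho) :=
  @Intertwiner C A (pullback pi) (pullback rho) f _ _ _.
Next Obligation. by move=> pi rho f z x y; exact: (itw_linear f). Qed.
Next Obligation. by move=> pi rho f x y; exact: (itw_isometric f). Qed.
Next Obligation. by move=> pi rho f a x; exact: (itw_comm f). Qed.

Program Definition pullback_functor :
    functor (rep_category B) (rep_category A) :=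
  @Functor (rep_category B) (rep_category A) pullback pullback_hom _ _.
Next Obligation. by move=> x; exact: intertwiner_eq. Qed.
Next Obligation. by move=> x y z f g; exact: intertwiner_eq. Qed.

(** Only the operators of [h (g b)] and [b] are compared, because for forms one of the two
    composites changes the element and preserves just its action. *)
Lemma nondegenerate_pullback (g : B -> A) (pi : starRep B) :
  (forall b, rep_op (h (g b)) =1 rep_op b :> (pi -> pi)) ->
  strongly_nondegenerate pi -> strongly_nondegenerate (pullback pi).
Proof.
move=> hg nd x; have [n [z [b [y ->]]]] := nd x.
by exists n, z, (g \o b), y; apply: eq_bigr => i _; rewrite /= hg.
Qed.

End Pullback.
End Hom.

Section Subcategories.
Variables (D E : category) (P : D -> Prop) (Q : E -> Prop) (S : functor D E).
Hypothesis PQ : forall x, P x -> Q (S x).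

Program Definition restrict_functor :
    functor (full_subcategory P) (full_subcategory Q) :=
  @Functor (full_subcategory P) (full_subcategory Q)
    (fun x => exist _ (S (sval x)) (PQ (svalP x))) (fun _ _ f => fhom S f) _ _.
Next Obligation. by move=> x; exact: fhom_id. Qed.
Next Obligation. by move=> x y z f g; exact: fhom_comp. Qed.

End Subcategories.

(** Full subcategories keep all morphisms, so the natural isomorphisms restrict componentwise. *)
Lemma equivalent_subcategories (D E : category) (P : D -> Prop) (Q : E -> Prop)
    (S : functor D E) (T : functor E D) :
  naturally_isomorphic (functor_comp T S) (functor_id D) ->
  naturally_isomorphic (functor_comp S T) (functor_id E) ->
  (forall x, P x -> Q (S x)) -> (forall y, Q y -> P (T y)) ->
  equivalent_categories (full_subcategory P) (full_subcategory Q).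
Proof.
move=> [u [v [uN vu uv]]] [u' [v' [uN' vu' uv']]] PQ QP.
exists (restrict_functor PQ), (restrict_functor QP); split.
  by exists (fun x => u (sval x)), (fun x => v (sval x));
    split=> [x y f|x|x]; [exact: uN|exact: vu|exact: uv].
by exists (fun x => u' (sval x)), (fun x => v' (sval x));
  split=> [x y f|x|x]; [exact: uN'|exact: vu'|exact: uv'].
Qed.

Section Equivalence.
Variables (C : numClosedFieldType) (A B : starAlgType C).
Variables (h : starHom A B) (g : starHom B A).

Hypothesis hg : forall b, h (g b) = b.
Hypothesis gh : forall (pi : starRep A) a, rep_op (g (h a)) =1 rep_op a :> (pi -> pi).

(** Pulling back twice keeps the space and, by [hg] and [gh], the action, so identity maps are the
    natural isomorphisms. *)
Lemma equivalent_of_section : equivalent_representation_theories A B.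
Proof.
have gh_iso : naturally_isomorphic
    (functor_comp (pullback_functor h) (pullback_functor g))
    (functor_id (rep_category A)).
  exists (fun pi => @Intertwiner C A (pullback h (pullback g pi)) pi id
      (fun _ _ _ => erefl) (fun _ _ => erefl) (fun a x => @gh pi a x)),
    (fun pi => @Intertwiner C A pi (pullback h (pullback g pi)) id
      (fun _ _ _ => erefl) (fun _ _ => erefl) (fun a x => esym (@gh pi a x))).
  by split=> *; exact: intertwiner_eq.
have hgE (pi : starRep B) b : rep_op (h (g b)) =1 rep_op b :> (pi -> pi).
  by rewrite hg.
have hg_iso : naturally_isomorphic
    (functor_comp (pullback_functor g) (pullback_functor h))
    (functor_id (rep_category B)).
  exists (fun pi => @Intertwiner C B (pullback g (pullback h pi)) pi id
      (fun _ _ _ => erefl) (fun _ _ => erefl) (fun b x => @hgE pi b x)),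
    (fun pi => @Intertwiner C B pi (pullback g (pullback h pi)) id
      (fun _ _ _ => erefl) (fun _ _ => erefl) (fun b x => esym (@hgE pi b x))).
  by split=> *; exact: intertwiner_eq.
split; first by exists (pullback_functor g), (pullback_functor h).
apply: equivalent_subcategories gh_iso hg_iso _ _ => pi.
  by apply: nondegenerate_pullback; exact: gh.
by apply: nondegenerate_pullback; exact: hgE.
Qed.

End Equivalence.

(** * Obstruction to Morita equivalence with a reduced algebra *)

Section Morita.
Variables (C : numClosedFieldType) (A B : starAlgType C) (u : A).
(** [F] abstracts the filtration of forms by degree, and [N] a bound beyond which it is zero. *)
Variables (F : nat -> set A) (N : nat).
Hypothesis mul1A : forall a : A, u ** a = a.
Hypothesis mulA1 : forall a : A, a ** u = a.
Hypothesis F0 : F 0 = setT.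
Hypothesis FM : forall k l a b, F k a -> F l b -> F (k + l)%N (a ** b).
Hypothesis FN : forall k a, (N <= k)%N -> F k a -> a = 0.
Hypothesis reducedB : forall b : B, b ** b = 0 -> b = 0.
Variable X : innerBimodule B A.
Hypothesis eqX : equivalence_bimodule X.

(* Descending induction on [k], bounded by [N]. *)
Lemma lip_nilpotent k a (x y : X) : (0 < k)%N -> F k a -> lip (ract x a) y = 0.
Proof.
have [n Nkn] : exists n, (N <= k + n)%N by exists N; rewrite leq_addl.
elim: n k a x Nkn => [|n IH] k a x Nkn k0 Fa.
  rewrite addn0 in Nkn; rewrite (FN Nkn Fa) (linear_map0 (ract_linr x)).
  exact: (linear_map0 (lip_lin y)).
apply: reducedB; rewrite -lip_act -(eqb_compatible eqX) rip_act -!ractM.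
(* The new right factor is [a ** (rip y x ** a)], whose middle term is only known to lie in [F 0].
   As [k] is positive, doubling it pays for the decrease of [n]. *)
apply: (IH (k + (0 + k))%N).
- by rewrite (leq_trans Nkn)// add0n -addSnnS leq_add2r -addn1 leq_add2l.
- by rewrite addn_gt0 k0.
- by apply: FM => //; apply: FM => //; rewrite F0.
Qed.

(** Fullness writes the unit as a combination of inner products. Compatibility then expresses
    [ract x a] through values of [lip] that vanish, so [ract x a = 0]; inserting the unit to the
    left of [a] finishes. *)
Lemma filtration_trivial a : F 1 a -> a = 0.
Proof.
move=> Fa; have [n [z [y [w uE]]]] := eqb_right_full eqX u.
have xa0 (x : X) : ract x a = 0.
  rewrite -(mulA1 a) ractM uE (linear_map_sum (ract_linr _)) big1// => i _.
  rewrite (eqb_compatible eqX) (lip_nilpotent _ _ _ Fa)//.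
  by rewrite (linear_map0 (lact_linl _)) scaler0.
rewrite -(mul1A a) uE (linear_map_sum (amul_linl a)) big1// => i _.
by rewrite -rip_act xa0 (linear_map0 (rip_lin _)) scaler0.
Qed.

End Morita.

(** * The one-dimensional pre-Hilbert space, on which point evaluations act *)

Definition hilbert_line (C : numClosedFieldType) : Type := C^o.

Section HilbertLine.
Variable C : numClosedFieldType.

HB.instance Definition _ := GRing.Lmodule.copy (hilbert_line C) C^o.

Program Definition hilbert_line_isPreHilbert :=
  @isPreHilbert.Build C (hilbert_line C) (fun x y : C => x^* * y) _ _ _.
Next Obligation.
move=> x z y y'.
exact: (etrans (mulrDr _ _ _) (congr1 (+%R^~ _) (mulrCA _ _ _))).
Qed.
Next Obligation.
move=> x y; have E (u v : C) : u^* * v = (v^* * u)^* by rewrite rmorphM /= conjCK mulrC.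
exact: E.
Qed.
Next Obligation.
move=> x x0; have E (u : C) : u != 0 -> 0 < u^* * u by rewrite mulrC mul_conjC_gt0.
exact: E.
Qed.
HB.instance Definition _ := hilbert_line_isPreHilbert.

End HilbertLine.

Lemma not_uniqP (T : eqType) (s : seq T) : ~~ uniq s ->
  exists x s1 s2 s3, s = s1 ++ x :: s2 ++ x :: s3.
Proof.
elim: s => [//|x s IH] /=; rewrite negb_and negbK => /orP[/path.splitPr|/IH].
  by case=> s2 s3; exists x, [::], s2, s3.
by case=> y [s1 [s2 [s3 ->]]]; exists y, (x :: s1), s2, s3.
Qed.

(** * Degree of forms, minimal ideal and closed ideals *)

Section Forms.
Variables (R : realType) (m : nat) (M : manifold R m).
Implicit Types (al be : diff_form M) (p : M).

Lemma form_zeroE p s : (0 : diff_form M) p s = 0.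
Proof. by case: s. Qed.

Definition degree_ge (k : nat) al : Prop :=
  forall p s, (size s < k)%N -> al p s = 0.

Lemma degree_geW j k al : (j <= k)%N -> degree_ge k al -> degree_ge j al.
Proof. by move=> jk ka p s /leq_trans/(_ jk); exact: ka. Qed.

Lemma degree_ge1 al : degree_ge 1 al <-> positive_degree M al.
Proof. by split=> [ka p|ka p [|v s]//]; exact: ka. Qed.

(** Each summand of the wedge distributes fewer than [j + k] arguments, so [al] receives fewer than
    [j] or [be] fewer than [k]. *)
Lemma degree_geM j k al be :
  degree_ge j al -> degree_ge k be -> degree_ge (j + k) (al ** be).
Proof.
move=> ja kb p s sjk; apply: big1 => b _.
have bs : size b = size s by rewrite size_tuple.
have [cj|jc] := ltnP (count id b) j.
  by rewrite ja ?mul0r ?mulr0 ?size_mask.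
rewrite kb ?mulr0// size_mask ?size_map// count_map.
rewrite -(ltn_add2l (count id b)) (leq_trans _ (leq_add jc (leqnn k)))//.
by rewrite (count_predC id) bs.
Qed.

(** Components are compared in every chart [j]: away from its domain all are 0 by convention, inside
    it the transition matrix carries over the expansion in [i]. *)
Lemma tangent_decomposition (i : chart M) p (v : tangent p) : chart_dom i p ->
  v = \sum_(a < m) v i 0 a *: coordinate_vector i a p.
Proof.
move=> ip; apply: tangent_eq => j.
have -> : (\sum_(a < m) v i 0 a *: coordinate_vector i a p) j =
    \sum_(a < m) (v i 0 a *: coordinate_vector i a p) j.
  by apply: (big_morph (fun w : tangent p => w j)).
have [jp|nj] := pselect (chart_dom j p); last first.
  by rewrite component_out// big1// => a _; rewrite component_out.
rewrite (component_transition v ip jp) {1}(row_sum_delta (v i)) mulmx_suml.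
apply: eq_bigr => a _ /=; case: asboolP => [_|[]//].
by rewrite scalemxAl.
Qed.

Lemma multilinear_sum (V : lmodType R) (f : seq V -> R[i]) s t n
    (c : 'I_n -> R) (v : 'I_n -> V) : multilinear f ->
  f (s ++ (\sum_(a < n) c a *: v a) :: t) =
  \sum_(a < n) (c a)%:C%C * f (s ++ v a :: t).
Proof.
move=> mf; elim: n c v => [|n IH] c v.
  (* The coefficient -1 shows that a multilinear map vanishes on a zero argument. *)
  have := mf s t (-1) 0 0; rewrite scaler0 addr0 !big_ord0.
  by rewrite rmorphN1 mulN1r addNr.
by rewrite !big_ord_recl mf IH.
Qed.

(** On coordinate vectors this is the pigeonhole principle; the general case follows by expanding
    the arguments. *)
Lemma alternating_form_eq0 p (f : seq (tangent p) -> R[i]) s :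
  multilinear f -> Defs.alternating f -> (m < size s)%N -> f s = 0.
Proof.
move=> mf af ms; have [i ip] := dom_cover p.
have basis (J : seq 'I_m) : (m < size J)%N ->
    f [seq coordinate_vector i a p | a <- J] = 0.
  move=> mJ; have : ~~ uniq J.
    apply: contraL mJ => /card_uniqP <-.
    by rewrite -leqNgt (leq_trans (max_card _)) ?card_ord.
  by case/not_uniqP => a [s1 [s2 [s3 ->]]]; rewrite !(map_cat, map_cons); exact: af.
(* [J] indexes the arguments already expanded, [t] holds those still arbitrary. *)
suff H t (J : seq 'I_m) : (m < size J + size t)%N ->
    f ([seq coordinate_vector i a p | a <- J] ++ t) = 0 by exact: (H s [::]).
elim: t J => [|v t IH] J; first by rewrite cats0 addn0; exact: basis.
move=> mJ; rewrite (tangent_decomposition v ip) multilinear_sum//.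
rewrite big1// => a _; rewrite -cat_rcons -map_rcons IH ?mulr0//.
by rewrite size_rcons addSnnS.
Qed.

Lemma degree_ge_dim al : degree_ge m.+1 al -> al = 0.
Proof.
move=> mal; apply: form_eq => p s; rewrite form_zeroE.
have [sm|ms] := leqP (size s) m; first exact: mal.
by apply: alternating_form_eq0 => //;
  [exact: form_multilinear|exact: form_alternating].
Qed.

Lemma degree_ge_iter n al : degree_ge 1 al -> degree_ge (2 ^ n) (iter n (@asqr _ _) al).
Proof.
move=> al1; elim: n => [//|n IH].
by rewrite iterS expnS mul2n -addnn; exact: degree_geM.
Qed.

(** After [m] squarings the degree is at least [2 ^ m], which exceeds the dimension. *)
Lemma positive_degree_nilpotent al :
  positive_degree M al -> iter m (@asqr _ _) al = 0.
Proof.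
move=> /degree_ge1 al1; apply: degree_ge_dim.
have m2 : (m < 2 ^ m)%N by exact: ltn_expl.
exact: degree_geW m2 (degree_ge_iter al1).
Qed.

(** The nilpotency argument is for Hermitian elements, so it is applied to the real and imaginary
    parts, again of positive degree. *)
Lemma positive_degree_killed (pi : starRep (diff_form M)) :
  positive_degree M `<=` rep_kernel pi.
Proof.
move=> al al1 x.
have kill be : star be = be -> positive_degree M be -> rep_op be x = 0.
  move=> beE be1; have be0 := positive_degree_nilpotent be1.
  exact: (rep_kernel_nilpotent beE be0).
have p1 : positive_degree M (real_part al).
  by move=> p; rewrite /= al1 /form_star al1 conjC0 addr0 mulr0.
have p2 : positive_degree M (imaginary_part al).
  by move=> p; rewrite /= al1 /form_star al1 conjC0 mulr0 addr0 mulr0.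
have k1 := kill _ (real_part_star al) p1.
have k2 := kill _ (imaginary_part_star al) p2.
rewrite (cartesian_decomposition al) repD (repZ _ (imaginary_part al)) k1 k2.
by rewrite scaler0 addr0.
Qed.

Program Definition form_inclusion : starHom (Cinfty M) (diff_form M) :=
  @StarHom _ (Cinfty M) (diff_form M) (@form_of_fun R m M) _ _ _.
Next Obligation.
by move=> z f g; apply: form_eq => p [|v s] //=; rewrite mulr0 addr0.
Qed.
Next Obligation.
move=> f g; apply: form_eq => p [|v s]; first by rewrite /= wedge_nil.
(* One of the two factors receives [v], and a form of degree zero vanishes on a nonempty list. *)
rewrite [LHS]/=; symmetry; apply: big1 => -[[|[] b] bs] //= _.
  by rewrite mul0r mulr0.
by rewrite !mulr0.
Qed.
Next Obligation.
move=> f; apply: form_eq => p [|v s] //=.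
by rewrite /form_star rev_cons; case: (rev s) => [|u t] /=; rewrite conjC0.
Qed.

Program Definition scalar_part al : Cinfty M :=
  @SmoothFunction R m M (fun p => al p [::]) _.
Next Obligation. by move=> al i; exact: (form_smooth al i [::]). Qed.

Program Definition form_projection : starHom (diff_form M) (Cinfty M) :=
  @StarHom _ (diff_form M) (Cinfty M) scalar_part _ _ _.
Next Obligation. by move=> z al be; exact: cinf_eq. Qed.
Next Obligation. by move=> al be; apply: cinf_eq => p /=; exact: wedge_nil. Qed.
Next Obligation. by move=> al; apply: cinf_eq. Qed.

Lemma scalar_part_fun f : scalar_part (form_of_fun f) = f.
Proof. exact: cinf_eq. Qed.

Lemma positive_part al :
  positive_degree M (al - form_of_fun (scalar_part al)).
Proof. by move=> p /=; rewrite mulN1r subrr. Qed.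

Lemma rep_scalar_part (pi : starRep (diff_form M)) al :
  rep_op (form_of_fun (scalar_part al)) =1 rep_op al :> (pi -> pi).
Proof.
move=> x; rewrite -[in RHS](subrK (form_of_fun (scalar_part al)) al) repD.
by rewrite (positive_degree_killed (@positive_part al)) add0r.
Qed.

Program Definition evaluation_rep p : starRep (Cinfty M) :=
  @StarRep _ (Cinfty M) (hilbert_line R[i])
    (fun f (z : R[i]) => f p * z) _ _ _ _.
Next Obligation. by move=> p f z x y /=; rewrite mulrDr mulrCA. Qed.
Next Obligation. by move=> p f x y; rewrite /hip /= rmorphM mulrCA mulrA. Qed.
Next Obligation.
move=> p z f g x; have E (u v w : R[i]) : (u * v + w) * x = u * (v * x) + w * x.
  by rewrite mulrDl mulrA.
exact: E.
Qed.
Next Obligation. by move=> p f g x /=; rewrite mulrA. Qed.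

Lemma minimal_ideal_forms : minimal_ideal (diff_form M) = positive_degree M.
Proof.
apply/seteqP; split=> [al min p|al al1 _ [pi ->]]; last exact: positive_degree_killed.
(* Evaluation at [p], pulled back to forms, sends the vector 1 to [al p [::]]. *)
have /= := min _ (ex_intro _ (pullback form_projection (evaluation_rep p)) erefl) 1.
by rewrite mulr1.
Qed.

(** Pullback along [form_inclusion] yields [I] from [J], and along [form_projection] yields [J] from
    [I]. *)
Lemma closed_ideal_forms (J : set (diff_form M)) : closed_ideal J <->
  exists I : set (Cinfty M), closed_ideal I /\
    J = [set form_of_fun f + al | f in I & al in positive_degree M].
Proof.
split=> [[pi ->]|[_ [[pi ->] ->]]].
  exists (rep_kernel (pullback form_inclusion pi)); split.
    by exists (pullback form_inclusion pi).
  apply/seteqP; split=> [al ka|_ [f kf [al al1 <-]] x].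
    exists (scalar_part al); first by move=> x /=; rewrite rep_scalar_part.
    by exists (al - form_of_fun (scalar_part al)); [exact: positive_part|
      rewrite addrC subrK].
  by rewrite repD (positive_degree_killed al1) addr0; exact: kf.
exists (pullback form_projection pi).
apply/seteqP; split=> [_ [f kf [al al1 <-]] x|al ka].
  rewrite repD /= scalar_part_fun kf add0r.
  rewrite (_ : scalar_part al = 0) ?rep0//; exact: cinf_eq.
exists (scalar_part al) => //.
by exists (al - form_of_fun (scalar_part al)); [exact: positive_part|rewrite addrC subrK].
Qed.

Lemma representation_theories_forms :
  equivalent_representation_theories (diff_form M) (Cinfty M).
Proof.
exact: (@equivalent_of_section _ _ _ form_projection form_inclusion
  scalar_part_fun rep_scalar_part).
Qed.

End Forms.

(** * Flat functions on the real line *)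

Section Flat.
Variable R : realType.
Implicit Types (n : nat) (t : R).

(* The derivatives of [exp (- 1 / t)] are combinations of the functions
   [t^-n exp (- 1 / t)], each of which extends smoothly by 0. *)
Definition flat n t : R := if 0 < t then t^-1 ^+ n * expR (- t^-1) else 0.

Lemma flat_le0 n t : t <= 0 -> flat n t = 0.
Proof. by rewrite /flat ltNge => ->. Qed.

Lemma flat_gt0 n t : 0 < t -> 0 < flat n t.
Proof. by move=> t0; rewrite /flat t0 mulr_gt0 ?expR_gt0// exprn_gt0 ?invr_gt0. Qed.

(** The exponential at [t^-1] dominates its series term of degree [n.+2]. The two spare powers give
    the quadratic bound that makes the derivative at 0 vanish. *)
Lemma flat_le n t : `|flat n t| <= n.+2`!%:R * t ^+ 2.
Proof.
have [t0|t0] := ltP 0 t; last by rewrite flat_le0// normr0 mulr_ge0 ?sqr_ge0.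
rewrite ger0_norm ?(ltW (flat_gt0 _ t0))// /flat t0 expRN ler_pdivrMr ?expR_gt0//.
have ti : 0 <= t^-1 by rewrite invr_ge0 ltW.
have f0 : 0 < n.+2`!%:R :> R by rewrite ltr0n fact_gt0.
have := expR_ge1Dxn n.+1 ti.
move=> /(le_trans (ler_wpDl ler01 (lexx _))).
rewrite ler_pdivrMr// => /(ler_wpM2l (sqr_ge0 t)).
rewrite -[n.+2]addn2 exprD mulrCA -exprMn divff ?gt_eqF// expr1n mulr1 => /le_trans.
by apply; rewrite mulrA mulrC mulrA.
Qed.

(** The function is locally zero left of 0, the usual rules apply right of 0, and at 0 [flat_le]
    controls the difference quotient. *)
Lemma is_derive_flat n t :
  is_derive t 1 (flat n) (flat n.+2 t - n%:R * flat n.+1 t).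
Proof.
have [t0|t0|t0] := ltgtP t 0.
- rewrite !flat_le0 ?ltW// mulr0 subr0.
  apply: (@near_eq_is_derive _ _ _ (cst 0)).
  by near=> s; rewrite flat_le0// ltW//; near: s; exact: lt_nbhsl.
- have t_neq0 : t != 0 by rewrite gt_eqF.
  have dV : is_derive t 1 (fun s : R => s^-1) (- t ^- 2 *: 1).
    exact: (@is_deriveV _ id).
  have dE := @is_derive1_comp R expR (- (fun s : R => s^-1)) t _ _
    (is_derive_expR (- t^-1)) (is_deriveN dV).
  have dX := is_deriveX n dV.
  have D := is_deriveM dX dE.
  have N : \near t, ((fun s : R => s^-1) ^+ n *
      (expR \o (- (fun s : R => s^-1)))) t = flat n t.
    near=> s; rewrite /flat ifT; last by near: s; exact: lt_nbhsr.
    by rewrite !fctE.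
  apply: (is_derive_eq (near_eq_is_derive N D)).
  rewrite /flat t0 !fctE /GRing.scale /= !mulr1 opprK -!exprVn.
  case: n {dX D N} => [|n]; rewrite !exprS ?expr0 /=; ring.
rewrite t0 !flat_le0// mulr0 subr0.
have H : (fun h => h^-1 *: (flat n (h *: 1 + 0) - flat n 0)) @ 0^' --> (0 : R).
  apply/cvgr0Pnorm_le => e e0.
  have c0 : 0 < n.+2`!%:R :> R by rewrite ltr0n fact_gt0.
  near=> h.
  have h0 : h != 0 by near: h; exact: nbhs_dnbhs_neq.
  rewrite [flat n 0]flat_le0// subr0 normrZ normfV [h *: 1]mulr1 addr0.
  rewrite ler_pdivrMl ?normr_gt0// (le_trans (flat_le _ _))//.
  rewrite -real_normK ?num_real// expr2 mulrCA ler_wpM2l//.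
  rewrite -ler_pdivlMl//; near: h; apply: dnbhs0_le.
  by rewrite mulr_gt0 ?invr_gt0.
apply: DeriveDef; first by apply/cvg_ex; exists 0.
exact/cvg_lim.
Unshelve. all: by end_near. Qed.

Lemma differentiable_flat n t : differentiable (flat n) t.
Proof. by apply/derivable1_diffP; case: (is_derive_flat n t). Qed.

Lemma derive_flat n t v :
  'D_v (flat n) t = v * (flat n.+2 t - n%:R * flat n.+1 t).
Proof.
have d := differentiable_flat n t.
have [_ <-] := is_derive_flat n t.
by rewrite !deriveE// -[in LHS](mulr1 v) linearZ.
Qed.

End Flat.

(** * Closure properties of finite-order differentiability *)

Section SmoothCalculus.
Variables (R : realType) (m : nat).
Implicit Types (U V : set 'rV[R]_m).

(** Differentiation raises the index of [flat], so the induction on [k] treats all [n] at once. *)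
Lemma differentiable_upto_flat k U (g : 'rV[R]_m -> R) n : open U ->
  differentiable_upto k U g -> differentiable_upto k U (flat n \o g).
Proof.
move=> oU; elim: k g n => [//|k IH] g n dg.
have dg1 := differentiable_uptoS dg; case: dg => [dg Dg]; split=> [x Ux|a].
  by apply: differentiable_comp; [exact: dg|exact: differentiable_flat].
have := differentiable_uptoM oU (Dg a) (differentiable_uptoD oU (IH g n.+2 dg1)
  (differentiable_uptoM oU (differentiable_upto_cst k (- n%:R : R) oU) (IH g n.+1 dg1))).
apply: (differentiable_upto_eq oU) => x Ux.
rewrite derive_comp ?derive_flat//; [|exact: dg|exact: differentiable_flat].
by rewrite !fctE mulNr.
Qed.

Lemma differentiable_upto_coord k U n (f : 'rV[R]_m -> 'rV[R]_n) b : open U ->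
  differentiable_upto k U f -> differentiable_upto k U (fun x => f x 0 b).
Proof.
move=> oU; elim: k f => [//|k IH] f [df Df]; split=> [x Ux|a].
  exact: (differentiable_comp (df x Ux) (differentiable_coord _ 0 b)).
apply: (differentiable_upto_eq oU _ (IH _ (Df a))) => x Ux.
rewrite derive_mx ?mxE//; exact/diff_derivable/df.
Qed.

Lemma differentiable_upto_prod k U n (F : 'I_n -> 'rV[R]_m -> R) : open U ->
  (forall a, differentiable_upto k U (F a)) ->
  differentiable_upto k U (fun x => \prod_(a < n) F a x).
Proof.
move=> oU; elim: n F => [|n IH] F dF.
  apply: (differentiable_upto_eq oU _ (differentiable_upto_cst k (1 : R) oU)) => x _.
  by rewrite big_ord0.
have := differentiable_uptoM oU (dF 0) (IH (fun a => F (lift 0 a)) (fun a => dF _)).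
by apply: (differentiable_upto_eq oU) => x _; rewrite big_ord_recl.
Qed.

Lemma differentiable_upto_local k (W : normedModType R) U (f : 'rV[R]_m -> W) :
  (forall x, U x -> exists2 V, V x & differentiable_upto k V f) ->
  differentiable_upto k U f.
Proof.
elim: k f => [//|k IH] f H; split=> [x /H[V Vx [df _]]|a]; first exact: df.
by apply: IH => x /H[V Vx [_ Df]]; exists V => //; exact: Df.
Qed.

End SmoothCalculus.

(** * Bump functions on boxes *)

Section Bump.
Variables (R : realType) (n : nat).
Implicit Types (c x : 'rV[R]_n) (r : R).

Definition box c r : set 'rV[R]_n :=
  [set x | forall a, `|x 0 a - c 0 a| <= r].

(** For positive [r], the factor of index [a] is positive exactly when coordinate [a] of [x] is at
    distance less than [r] from that of [c]. *)
Definition box_bump c r x : R :=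
  \prod_(a < n) (flat 0 (r + (x 0 a - c 0 a)) * flat 0 (r - (x 0 a - c 0 a))).

Lemma box_bump_out c r x : ~ box c r x -> box_bump c r x = 0.
Proof.
move=> /existsNP[a /negP]; rewrite -ltNge ltr_normr => xa.
rewrite /box_bump (bigD1 a)//=; case/orP: xa => xa.
  by rewrite [flat 0 (r - _)]flat_le0 ?mulr0 ?mul0r// subr_le0 ltW.
by rewrite flat_le0 ?mul0r//; lra.
Qed.

Lemma box_bump_center c r : 0 < r -> 0 < box_bump c r c.
Proof.
by move=> r0; apply: prodr_gt0 => a _; rewrite subrr addr0 subr0 mulr_gt0 ?flat_gt0.
Qed.

Lemma compact_box c r : compact (box c r).
Proof.
have := @rV_compact R n (fun a => `[c 0 a - r, c 0 a + r]%classic)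
  (fun a => @segment_compact _ _ _).
congr compact; apply/seteqP; split=> x H a; have := H a;
  by rewrite /= in_itv /= ler_distl.
Qed.

Lemma box_nbhs c (U : set 'rV[R]_n) : nbhs c U ->
  exists2 r : R, 0 < r & box c r `<=` U.
Proof.
(* Halving the radius fits the closed box into the open ball. *)
move=> /nbhs_ballP[e /= e0 eU]; exists (e / 2); first by rewrite divr_gt0.
move=> x xc; apply: eU; split=> // i j; rewrite ord1 /ball /=.
by rewrite distrC (le_lt_trans (xc j))//; lra.
Qed.

Lemma differentiable_upto_box_bump m k (U : set 'rV[R]_m) c r
    (f : 'rV[R]_m -> 'rV[R]_n) : open U ->
  differentiable_upto k U f -> differentiable_upto k U (box_bump c r \o f).
Proof.
move=> oU df; apply: differentiable_upto_prod => // a.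
have dfa := differentiable_upto_coord a oU df.
have cst (z : R) := differentiable_upto_cst k z oU.
apply: differentiable_uptoM => //; apply: (differentiable_upto_flat 0 oU).
  apply: (differentiable_upto_eq oU _ (differentiable_uptoD oU (cst r)
    (differentiable_uptoD oU dfa (cst (- c 0 a))))) => x _.
  by rewrite !fctE.
apply: (differentiable_upto_eq oU _ (differentiable_uptoD oU (cst r)
  (differentiable_uptoM oU (cst (-1))
    (differentiable_uptoD oU dfa (cst (- c 0 a)))))) => x _.
by rewrite !fctE mulN1r.
Qed.

End Bump.

(** * A coordinate one-form cut off by a bump function *)

Section BumpForm.
Variables (R : realType) (m : nat) (M : manifold R m).
Variables (i : chart M) (c : 'rV[R]_m) (r : R) (a : 'I_m).
Hypothesis box_chart : box c r `<=` chart_coord i @` chart_dom i.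

(** Components in a chart not containing [p] are 0 by convention, so this formula already extends
    the form by 0 to [M]. *)
Definition bump_form_at (p : M) (s : seq (tangent p)) : R[i] :=
  if s is [:: v] then (box_bump c r (chart_coord i p) * v i 0 a)%:C%C else 0.

Lemma box_chart_param u : box c r u -> chart_dom i (chart_param i u).
Proof. by move=> /box_chart[p ip <-]; rewrite coordK. Qed.

(** A compact set in a Hausdorff space is closed. The complement is thus open, which makes the
    extension by 0 smooth. *)
Lemma closed_box_image : closed (chart_param i @` box c r).
Proof.
apply: compact_closed; first exact: manifold_hausdorff.
apply: continuous_compact; last exact: compact_box.
apply: continuous_in_subspaceT => u /set_mem /box_chart.
exact: param_continuous.
Qed.

Lemma bump_form_out p (v : tangent p) : ~ (chart_param i @` box c r) p ->
  box_bump c r (chart_coord i p) * v i 0 a = 0.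
Proof.
move=> np; have [ip|nip] := pselect (chart_dom i p); last first.
  by rewrite component_out// mxE mulr0.
rewrite box_bump_out ?mul0r// => bp; apply: np.
by exists (chart_coord i p); rewrite ?coordK.
Qed.

(** On the image of the box the coefficient is the bump after the transition map times a Jacobian
    entry; off this closed set it vanishes locally. *)
Lemma smooth_bump_coefficient (j : chart M) (b : 'I_m) :
  smooth_on (chart_coord j @` chart_dom j)
    (fun x => box_bump c r (chart_coord i (chart_param j x)) *
       coordinate_vector j b (chart_param j x) i 0 a).
Proof.
move=> k; apply: differentiable_upto_local => x jx.
have [px|npx] := pselect ((chart_param i @` box c r) (chart_param j x)).
  exists (chart_coord j @` (chart_dom j `&` chart_dom i)).
    case: jx px => q jq <-; rewrite coordK// => -[u bu uq].
    by exists q => //; split=> //; rewrite -uq; exact: box_chart_param.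
  have oV := @overlap_open _ _ M j i; set V := _ @` _ in oV *.
  have T := @transition_smooth _ _ M j i.
  (* The Jacobian entry is a first derivative, hence the order [k.+1] for the transition map. *)
  have := differentiable_uptoM oV (differentiable_upto_box_bump c r oV (T k))
    (differentiable_upto_coord a oV ((T k.+1).2 b)).
  apply: (differentiable_upto_eq oV) => _ [q [jq iq] <-].
  rewrite fctE /= coordK//; congr (_ * _); case: asboolP => [_|[]//].
  by rewrite deriveEjacobian //; exact: transition_differentiable.
exists ((chart_coord j @` chart_dom j) `&`
    (chart_param j @^-1` (~` (chart_param i @` box c r)))) => //.
set V := _ `&` _; have oV : open V.
  rewrite openE => y [jy ny]; apply: filterI.
    by apply: open_nbhs_nbhs; split=> //; exact: img_open.
  apply: (param_continuous jy); apply: open_nbhs_nbhs; split=> //.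
  exact/closed_openC/closed_box_image.
apply: (differentiable_upto_eq oV _ (differentiable_upto_cst k (0 : R) oV)).
by move=> y [_ ny]; rewrite bump_form_out.
Qed.

Program Definition bump_form : diff_form M :=
  @Form R m M bump_form_at _ _ _.
Next Obligation.
move=> p [|x [|y s]] [|z t] w v v' /=; rewrite ?mulr0 ?addr0//.
rewrite -rmorphM -rmorphD !mxE; congr (_%:C)%C; ring.
Qed.
Next Obligation. by move=> p [|x [|y s]] [|z t] t' v. Qed.
Next Obligation.
move=> j [|b [|b' J]] /=; [|split|]; try by apply: csmooth_on_cst; exact: img_open.
  exact: smooth_bump_coefficient.
by move=> k; apply: differentiable_upto_cst; exact: img_open.
Qed.

Lemma bump_form_neq0 p : 0 < r -> chart_dom i p -> chart_coord i p = c ->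
  bump_form != 0.
Proof.
move=> r0 ip pc; apply/eqP.
move=> /(congr1 (fun al : diff_form M => al p [:: coordinate_vector i a p])).
rewrite form_zeroE /= pc => /complexI/eqP.
rewrite mulf_eq0 gt_eqF ?box_bump_center//= => /eqP.
case: asboolP => [_|[]//].
(* The remaining factor is a diagonal entry of the transition from [i] to itself, a map that is
   locally the identity. *)
have ii := transition_differentiable ip ip.
have N : \forall x \near chart_coord i p, (chart_coord i \o chart_param i) x = id x.
  have : nbhs (chart_coord i p) (chart_coord i @` chart_dom i).
    by apply: open_nbhs_nbhs; split; [exact: img_open|exists p].
  by apply: filterS => _ [q iq <-] /=; rewrite coordK.
rewrite /transition -deriveEjacobian// (near_eq_derive _ N) derive_id.
by rewrite mxE !eqxx => /eqP; rewrite oner_eq0.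
Qed.

End BumpForm.

(** * Failure of Morita equivalence for forms and functions *)

Section NotMorita.
Variables (R : realType) (m : nat) (M : manifold R m).

Lemma exists_positive_form : (0 < m)%N -> [set: M] !=set0 ->
  exists2 al : diff_form M, degree_ge 1 al & al != 0.
Proof.
move=> m0 [p _]; have [i ip] := dom_cover p.
have [r r0 rU] : exists2 r : R, 0 < r &
    box (chart_coord i p) r `<=` chart_coord i @` chart_dom i.
  by apply: box_nbhs; apply: open_nbhs_nbhs; split; [exact: img_open|exists p].
exists (bump_form (Ordinal m0) rU); last exact: bump_form_neq0 r0 ip erefl.
by move=> q [|v s].
Qed.

Definition form_one : diff_form M := form_of_fun (cinf_cst M 1).

Lemma form_mul1 (al : diff_form M) : form_one ** al = al.
Proof.
apply: form_eq => p s.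
suff H (f : seq (tangent p) -> R[i]) :
    wedge_at (degree_zero (fun=> 1) (p := p)) f s = f s by exact: H.
elim: s f => [|v s IH] f; first by rewrite wedge_nil mul1r.
rewrite wedge_cons wedge0l add0r.
(* The degree sign fixes a form of degree zero, so only the contraction of [f] by [v] remains. *)
rewrite (eq_wedge (al' := degree_zero (fun=> 1) (p := p))
  (be' := fun t => f (v :: t))) ?IH// => -[|u t] /=; by rewrite ?mulr0 ?mulr1.
Qed.

Lemma form_one_star : star form_one = form_one.
Proof.
rewrite -[form_one]/(form_inclusion M (cinf_cst M 1)) -star_hom_star.
by congr (form_inclusion M _); apply: cinf_eq => p /=; exact: conjC1.
Qed.

Lemma form_mulr1 (al : diff_form M) : al ** form_one = al.
Proof. by rewrite -[LHS]starK starM form_one_star form_mul1 starK. Qed.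

(** The two hypotheses provide a nonzero form of positive degree. The obstruction applies with the
    degree filtration, zero from [m.+1] on, and functions are reduced since their values lie in a
    field. *)
Lemma not_Morita_equivalent_forms : (0 < m)%N -> [set: M] !=set0 ->
  ~ formally_Morita_equivalent (diff_form M) (Cinfty M).
Proof.
move=> m0 M0 [X eqX]; have [al al1] := exists_positive_form m0 M0.
apply/negP; rewrite negbK; apply/eqP.
apply: (@filtration_trivial _ _ _ form_one
  (@degree_ge R m M) m.+1 _ _ _ _ _ _ X eqX _ al1).
- exact: form_mul1.
- exact: form_mulr1.
- by apply/seteqP; split.
- exact: degree_geM.
- by move=> k a mk ka; exact/degree_ge_dim/(degree_geW mk).
- move=> b bb; apply: cinf_eq => p; apply/eqP; rewrite -[_ == _]orbb -mulf_eq0.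
  by apply/eqP; exact: (congr1 (fun f : Cinfty M => f p) bb).
Qed.

End NotMorita.

Theorem proposition6p4 (R : realType) (m : nat) (M : manifold R m) :
  [/\ minimal_ideal (diff_form M) = positive_degree M,
      equivalent_representation_theories (diff_form M) (Cinfty M),
      (0 < m)%N -> [set: M] !=set0 ->
        ~ formally_Morita_equivalent (diff_form M) (Cinfty M)
    & forall J : set (diff_form M), closed_ideal J <->
        exists I : set (Cinfty M), closed_ideal I /\
          J = [set form_of_fun f + al | f in I & al in positive_degree M]].
Proof.
split; [exact: minimal_ideal_forms|exact: representation_theories_forms|
  exact: not_Morita_equivalent_forms|exact: closed_ideal_forms].
Qed.
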